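(* Let $N\ge 1$ and let $\lambda,\mu$, $M_j,\bar M_j$, $c_j,\bar c_j$ ($j=1,\dots,N$) be real constants such that $\lambda\neq 0$, $\mu\neq 0$, $\lambda^2\neq\mu^2$, $\bar M_j\neq M_k$ for all $j,k$, and $\lambda,\mu\notin\{\pm M_j,\pm\bar M_j: j=1,\dots,N\}$. Let $\mathsf M=\mathrm{diag}(M_1,\dots,M_N)$, $\bar{\mathsf M}=\mathrm{diag}(\bar M_1,\dots,\bar M_N)$ and, for $\zeta\in\{\lambda,\mu\}$, $$\mathsf H_\zeta=(\mathsf M-\zeta)(\mathsf M+\zeta)^{-1},\quad \bar{\mathsf H}_\zeta=(\bar{\mathsf M}+\zeta)(\bar{\mathsf M}-\zeta)^{-1},\quad \mathsf L_\zeta=\mathsf H_\zeta-\mathsf H_\zeta^{-1},\quad \bar{\mathsf L}_\zeta=\bar{\mathsf H}_\zeta-\bar{\mathsf H}_\zeta^{-1}$$ (here $\mathsf M-\zeta$ means $\mathsf M-\zeta\mathsf 1$, etc.). Let $\mathsf A_0,\bar{\mathsf A}_0$ be the $N\times N$ matrices with entries $(\mathsf A_0)_{jk}=\dfrac{c_k}{\bar M_j-M_k}$ and $(\bar{\mathsf A}_0)_{jk}=\dfrac{\bar c_k}{M_j-\bar M_k}$, and for $(x,y,n_1,n_2)\in\mathbb R^2\times\mathbb Z^2$ set $$\mathsf A(x,y,n_1,n_2)=\mathsf A_0\exp(x\mathsf L_\lambda+y\mathsf L_\mu)\,\mathsf H_\lambda^{n_1+n_2}\mathsf H_\mu^{n_2-n_1},\qquad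 \bar{\mathsf A}(x,y,n_1,n_2)=\bar{\mathsf A}_0\exp(x\bar{\mathsf L}_\lambda+y\bar{\mathsf L}_\mu)\,\bar{\mathsf H}_\lambda^{n_1+n_2}\bar{\mathsf H}_\mu^{n_2-n_1},$$ $$\varphi(x,y,n_1,n_2)=8xy\,\frac{\lambda\mu(\lambda^2+\mu^2)}{(\lambda^2-\mu^2)^2}+(n_1^2-n_2^2)\ln\left|\frac{\lambda+\mu}{\lambda-\mu}\right|.$$ Assume that $\det\big(\mathsf 1+\mathsf A(x,y,n_1,n_2)\bar{\mathsf A}(x,y,n_1,n_2)\big)>0$ for all $(x,y,n_1,n_2)\in\mathbb R^2\times\mathbb Z^2$, and define $$u(x,y,n_1,n_2)=\varphi(x,y,n_1,n_2)+\ln\det\big(\mathsf 1+\mathsf A(x,y,n_1,n_2)\bar{\mathsf A}(x,y,n_1,n_2)\big).$$ Then $u$ satisfies the $(2+2)$-dimensional Toda lattice equation $$\frac{\partial^2 u}{\partial x\,\partial y}=e^{\Delta_1 u}-e^{\Delta_2 u}$$ for all $(x,y,n_1,n_2)\in\mathbb R^2\times\mathbb Z^2$, where $\Delta_1u(n_1,n_2)=u(n_1+1,n_2)-2u(n_1,n_2)+u(n_1-1,n_2)$ and $\Delta_2u(n_1,n_2)=u(n_1,n_2+1)-2u(n_1,n_2)+u(n_1,n_2-1)$ (with $x,y$ fixed).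
   Context: All matrices and constants are real; $\mathsf 1$ is the $N\times N$ identity matrix. The functions $u$ are functions of two continuous variables $x,y$ and two integer variables $n_1,n_2$. *)

(* Defs.v *)
From HB Require Import structures.
From mathcomp Require Import all_boot all_order all_algebra.
From mathcomp Require Import all_classical all_reals all_analysis.
Set Implicit Arguments. Unset Strict Implicit. Unset Printing Implicit Defensive.
Import Order.TTheory GRing.Theory Num.Theory.
Local Open Scope ring_scope.

Section Toda.
Variable R : realType.
Variable n : nat.
Local Notation N := n.+1.

Definition mexp (A : 'M[R]_N) : 'M[R]_N :=
  limn (series (fun k : nat => (k`!%:R)^-1 *: A ^+ k)).

Variables (M Mb c cb : 'I_N -> R).

Definition diagf (d : 'I_N -> R) : 'M[R]_N := diag_mx (\row_j d j).

Definition Hm (z : R) : 'M[R]_N :=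
  (diagf M - z%:M) *m invmx (diagf M + z%:M).
Definition Hbm (z : R) : 'M[R]_N :=
  (diagf Mb + z%:M) *m invmx (diagf Mb - z%:M).
Definition Lm (z : R) : 'M[R]_N := Hm z - invmx (Hm z).
Definition Lbm (z : R) : 'M[R]_N := Hbm z - invmx (Hbm z).

Definition A0 : 'M[R]_N := \matrix_(j, k) (c k / (Mb j - M k)).
Definition Ab0 : 'M[R]_N := \matrix_(j, k) (cb k / (M j - Mb k)).

Variables (lam mu : R).

Definition Amat (x y : R) (n1 n2 : int) : 'M[R]_N :=
  A0 *m mexp (x *: Lm lam + y *: Lm mu) *m (Hm lam ^ (n1 + n2)) *m (Hm mu ^ (n2 - n1)).
Definition Abmat (x y : R) (n1 n2 : int) : 'M[R]_N :=
  Ab0 *m mexp (x *: Lbm lam + y *: Lbm mu) *m (Hbm lam ^ (n1 + n2)) *m (Hbm mu ^ (n2 - n1)).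

Definition phi (x y : R) (n1 n2 : int) : R :=
  8 * x * y * (lam * mu * (lam ^+ 2 + mu ^+ 2)) / (lam ^+ 2 - mu ^+ 2) ^+ 2
  + (n1 ^+ 2 - n2 ^+ 2)%:~R * ln `|(lam + mu) / (lam - mu)|.

Definition tau (x y : R) (n1 n2 : int) : R :=
  \det (1%:M + Amat x y n1 n2 *m Abmat x y n1 n2).

Definition u (x y : R) (n1 n2 : int) : R := phi x y n1 n2 + ln (tau x y n1 n2).

End Toda.

(* Main.v *)
Require Import Defs.
From HB Require Import structures.
From mathcomp Require Import all_boot all_order all_algebra.
From mathcomp Require Import all_classical all_reals all_analysis.
From mathcomp Require Import perm ring.
Set Implicit Arguments. Unset Strict Implicit. Unset Printing Implicit Defensive.
Import Order.TTheory GRing.Theory Num.Theory.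
Local Open Scope ring_scope.

(** Put the two matrices into the block matrix [W = [[1, A], [- Ab, 1]]], so that
    [tau = \det W]. With [D = diag(Mb, M)] the Cauchy form of the entries makes the
    commutator [D W - W D = E C] of rank two. Hence everything is governed by the
    2 x 2 monodromy matrix [Psi z = 1 - C W^-1 (D - z)^-1 E], of determinant 1:

    - a lattice step multiplies the exponentials by
      [(M - a1)(M - a2) / ((M - b1)(M - b2))] with [{a1, a2, b1, b2}] the four points
      [lam, - lam, mu, - mu]; it is a rank-four perturbation of [W] up to conjugation,
      and [tau'/tau] is a 4 x 4 determinant built from one column of [Psi] at each point;
    - both continuous flows are combinations of the elementary flows of symbol
      [1 / (M - a)], and [(a - b)^2] times the mixed logarithmic derivative for [a], [b]
      is the product of the diagonal entries of [(Psi a)^-1 Psi b], minus 1.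

    The equation thereby becomes a polynomial identity between four 2 x 2 matrices of
    determinant 1 ([four_point_identity]). *)

(** * Commutators of rank two *)

(* Decides identities that become linear over the distributed products. *)
Ltac mxlin :=
  rewrite ?(mulmxDl, mulmxDr, mulmxBl, mulmxBr, mulNmx, mulmxN, mul1mx, mulmx1,
    mul0mx, mulmx0, mulmxA, =^~ scalemxAl, =^~ scalemxAr);
  repeat match goal with |- context [?A *m ?B] => move: (A *m B) => ? end;
  apply/matrixP => ? ?; rewrite !mxE; ring.

(** Schur complement of the lower right unit block; this is what turns [tau] into [\det W]. *)
Lemma det_1mxM_block (K : comNzRingType) (p q : nat) (U : 'M[K]_(p, q)) (V : 'M[K]_(q, p)) :
  \det (block_mx 1%:M U (- V) 1%:M) = \det (1%:M + U *m V).
Proof.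
have -> : block_mx 1%:M U (- V) 1%:M =
    block_mx 1%:M U 0 1%:M *m block_mx (1%:M + U *m V) 0 (- V) 1%:M.
  rewrite mulmx_block !(mul1mx, mul0mx, mulmx1, mulmx0, mulmxN) add0r addrK.
  by rewrite !add0r.
by rewrite det_mulmx det_ublock det_lblock !det1 !mul1r mulr1.
Qed.

(** Sylvester's identity, from the other block factorization of the same matrix. It links
    determinants of size [m] to determinants of the size of a perturbation's rank: two in
    [det_monodromy], four in [det_two_shifts]. *)
Lemma det_1mxMC (K : comNzRingType) (p q : nat) (U : 'M[K]_(p, q)) (V : 'M[K]_(q, p)) :
  \det (1%:M + U *m V) = \det (1%:M + V *m U).
Proof.
rewrite -det_1mxM_block.
have -> : block_mx 1%:M U (- V) 1%:M =
    block_mx 1%:M 0 (- V) 1%:M *m block_mx 1%:M U 0 (1%:M + V *m U).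
  rewrite mulmx_block !(mul1mx, mul0mx, mulmx1, mulmx0, mulNmx, addr0).
  by rewrite [1%:M + _]addrC addKr.
by rewrite det_mulmx det_ublock det_lblock !det1 !mul1r.
Qed.

Section RankTwo.
Variables (K : numFieldType) (m : nat).
Variables (D W X : 'M[K]_m) (E : 'M[K]_(m, 2)) (C : 'M[K]_(2, m)).
Hypothesis comm_DW : D *m W - W *m D = E *m C.
Hypotheses (XW : X *m W = 1%:M) (WX : W *m X = 1%:M).

(** Multiply [comm_DW] by [X] on both sides: the commutator of the inverse with [D] factors through
    dimension two as well. *)
Lemma comm_inv : X *m E *m C *m X = X *m D - D *m X.
Proof.
rewrite -[X *m E *m C]mulmxA -comm_DW mulmxBr mulmxBl -!mulmxA WX mulmx1.
by rewrite [X *m (W *m _)]mulmxA XW mul1mx.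
Qed.

(** The hypotheses make [Za] and [Zb] one-sided resolvents of [D] at [a] and [b]. Placing [comm_inv]
    between them leaves [D] only through these two scalars. *)
Lemma resolvent_inv (a b : K) (Za Zb : 'M[K]_m) :
    Za *m D = 1%:M + a *: Za -> D *m Zb = 1%:M + b *: Zb ->
  Za *m X *m E *m C *m X *m Zb
  = Za *m X - X *m Zb - (a - b) *: (Za *m X *m Zb).
Proof.
move=> ZaD DZb.
have -> : Za *m X *m E *m C *m X *m Zb = Za *m (X *m E *m C *m X) *m Zb by rewrite !mulmxA.
rewrite comm_inv mulmxBr mulmxBl.
have -> : Za *m (X *m D) *m Zb = Za *m X *m (D *m Zb) by rewrite !mulmxA.
have -> : Za *m (D *m X) *m Zb = (Za *m D) *m X *m Zb by rewrite !mulmxA.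
rewrite ZaD DZb; mxlin.
Qed.

(** By cyclicity and [comm_inv] this is the trace of [X (D Z - Z D)], and [Z] commutes with [D]. *)
Lemma trace_comm_inv (c : K) (Z : 'M[K]_m) :
    Z *m D = 1%:M + c *: Z -> D *m Z = 1%:M + c *: Z ->
  \tr (C *m X *m Z *m X *m E) = 0.
Proof.
move=> ZD DZ; rewrite mxtrace_mulC !mulmxA mxtrace_mulC !mulmxA.
rewrite comm_inv mulmxBl raddfB /= -mulmxA DZ.
by rewrite [\tr (D *m X *m Z)]mxtrace_mulC !mulmxA ZD [\tr (_ *m X)]mxtrace_mulC subrr.
Qed.

End RankTwo.

(** * The monodromy matrix *)

Section Monodromy.
Variables (K : numFieldType) (m : nat).
Variables (D W X : 'M[K]_m) (E : 'M[K]_(m, 2)) (C : 'M[K]_(2, m)).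
Hypothesis comm_DW : D *m W - W *m D = E *m C.
Hypotheses (XW : X *m W = 1%:M) (WX : W *m X = 1%:M).

(** [Z] stands for the resolvent of [D] at a point and is kept abstract; [monodromyV] will be the
    inverse, with [X] and [Z] interchanged. *)
Definition monodromy (Z : 'M[K]_m) : 'M[K]_2 := 1%:M - C *m X *m Z *m E.
Definition monodromyV (Z : 'M[K]_m) : 'M[K]_2 := 1%:M + C *m Z *m X *m E.

(** [resolvent_inv] at coinciding points turns the quadratic term of the product into the difference
    that cancels the two linear ones. *)
Lemma monodromyVK (a : K) (Z : 'M[K]_m) :
    Z *m D = 1%:M + a *: Z -> D *m Z = 1%:M + a *: Z ->
  monodromyV Z *m monodromy Z = 1%:M.
Proof.
move=> ZD DZ; rewrite /monodromyV /monodromy mulmxBr !mulmxDl !mulmx1 mul1mx.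
have -> : C *m Z *m X *m E *m (C *m X *m Z *m E) =
    C *m (Z *m X *m E *m C *m X *m Z) *m E by rewrite !mulmxA.
rewrite (resolvent_inv comm_DW XW WX ZD DZ) subrr scale0r subr0; mxlin.
Qed.

(** Sylvester's identity moves the determinant to size [m], where the matrix becomes
    [X Z W (D - a)]; the determinants of its factors cancel in pairs. *)
Lemma det_monodromy (a : K) (Z : 'M[K]_m) :
    Z *m D = 1%:M + a *: Z -> D *m Z = 1%:M + a *: Z ->
  \det (monodromy Z) = 1.
Proof.
move=> ZD DZ; rewrite /monodromy -mulmxN -!mulmxA -det_1mxMC.
have ZDa : Z *m (D - a%:M) = 1%:M by rewrite mulmxBr mul_mx_scalar ZD addrK.
have -> : 1%:M + X *m (Z *m - E) *m C = X *m (Z *m W) *m (D - a%:M).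
  have -> : X *m (Z *m W) *m (D - a%:M) = X *m Z *m (W *m D - a *: W).
    by rewrite !mulmxBr !mul_mx_scalar -scalemxAr !mulmxA.
  have -> : W *m D = D *m W - E *m C by rewrite -comm_DW opprB addrC subrK.
  rewrite -{1}XW !(mulmxBr, mulmxN, mulNmx) !mulmxA -[X *m Z *m D]mulmxA ZD; mxlin.
have dXW : \det X * \det W = 1 by rewrite -det_mulmx XW det1.
have dZD : \det Z * \det (D - a%:M) = 1 by rewrite -det_mulmx ZDa det1.
by rewrite !det_mulmx [\det Z * _]mulrC mulrA dXW mul1r.
Qed.

(** * Rank-four perturbations of [W] *)

Section TwoShifts.
Variables (U1 U2 : 'M[K]_(m, 2)) (L1 L2 : 'M[K]_2) (T : 'M[K]_2).
Hypotheses (DU1 : D *m U1 = E + U1 *m L1) (DU2 : D *m U2 = E + U2 *m L2).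
Hypothesis TL : T *m (L1 - L2) = 1%:M.
(** For diagonal [L1], [L2], [T], the rows of [R1] and [R2] are those of [C] times the Lagrange
    polynomials of the nodes in [L1] and [L2], evaluated at [D]; accordingly [R1 + R2 = C]. *)
Let R1 := T *m (C *m D - L2 *m C).
Let R2 := - (T *m (C *m D - L1 *m C)).
Let P1 := 1%:M - C *m X *m U1.
Let P2 := 1%:M - C *m X *m U2.

(* [D X = X D - X E C X] expresses [C D X U1] and [C D X U2] through [C X U1], [C X U2]
   and [C X E]; row operations then eliminate [C X E]. *)
Lemma det_two_shifts :
  \det (W - U1 *m R1 - U2 *m R2)
  = \det W * (\det T * \det (block_mx P1 P2 (P1 *m L1) (P2 *m L2))).
Proof.
have -> r1 r2 : W - U1 *m r1 - U2 *m r2 =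
    W *m (1%:M + (X *m row_mx U1 U2) *m - col_mx r1 r2).
  rewrite mulmxDr mulmx1 !mulmxA WX mul1mx mulmxN mul_row_col.
  by rewrite opprD addrA.
rewrite det_mulmx det_1mxMC; congr (_ * _).
set Q := C *m X *m E.
have CDX U L : D *m U = E + U *m L ->
    C *m D *m X *m U = Q + C *m X *m U *m L - Q *m (C *m X *m U).
  move=> DU; rewrite /Q.
  have -> : C *m D *m X *m U = C *m (D *m X) *m U by rewrite !mulmxA.
  have -> : D *m X = X *m D - X *m E *m C *m X by rewrite (comm_inv comm_DW XW WX) subKr.
  rewrite !mulmxBr !mulmxBl !mulmxA -[C *m X *m D *m U]mulmxA DU; mxlin.
have blk U L L' : D *m U = E + U *m L ->
    T *m (C *m D - L' *m C) *m X *m U =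
    T *m (L - L') - T *m ((1%:M - C *m X *m U) *m L) + T *m (Q + L') *m (1%:M - C *m X *m U).
  move=> DU; rewrite -!mulmxA !mulmxBl -!mulmxA.
  rewrite [C *m (D *m _)]mulmxA [C *m D *m _]mulmxA (CDX _ _ DU); mxlin.
have -> r1 r2 : 1%:M + - col_mx r1 r2 *m (X *m row_mx U1 U2) =
    block_mx (1%:M - r1 *m X *m U1) (- (r1 *m X *m U2))
             (- (r2 *m X *m U1)) (1%:M - r2 *m X *m U2).
  rewrite mul_mx_row mulNmx mul_col_row -!mulmxA.
  by rewrite (@scalar_mx_block _ 2 2) opp_block_mx add_block_mx !add0r.
(* The left factors perform the row operations. Since [T] has even size, [- T] contributes just
   [\det T]. *)
have -> : block_mx (1%:M - R1 *m X *m U1) (- (R1 *m X *m U2))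
             (- (R2 *m X *m U1)) (1%:M - R2 *m X *m U2) =
    block_mx 1%:M (- 1%:M) 0 1%:M *m block_mx 1%:M 0 (T *m (Q + L1)) (- T)
    *m block_mx P1 P2 (P1 *m L1) (P2 *m L2).
  have T1 : T *m L1 = 1%:M + T *m L2 by rewrite -TL mulmxBr subrK.
  rewrite !mulmx_block /R1 /R2 !mulNmx !(blk _ _ _ DU1) !(blk _ _ _ DU2) -/P1 -/P2 TL !subrr !mulmx0.
  have -> : T *m (L2 - L1) = - 1%:M by rewrite -TL -mulmxN opprB.
  have -> : T *m (Q + L1) = 1%:M + T *m (Q + L2) by rewrite !mulmxDr T1 addrCA.
  by move: P1 P2 (Q) => p1 p2 q; congr block_mx; mxlin.
rewrite !det_mulmx det_ublock det_lblock !det1 !mul1r.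
by rewrite -scaleN1r detZ sqrrN expr1n mul1r.
Qed.

End TwoShifts.

(** * The mixed logarithmic derivative through a sign grading *)

Section Grading.
Variables (S : 'M[K]_m) (s : 'M[K]_2).
Hypotheses (SS : S *m S = 1%:M) (ss : s *m s = 1%:M) (SD : S *m D = D *m S).
Hypotheses (SE : S *m E = E *m s) (CS : C *m S = - (s *m C)).
Hypothesis SWS : W + S *m W *m S = 2%:R *: 1%:M.
Variables (a b : K) (Za Zb : 'M[K]_m).
Hypotheses (ZaD : Za *m D = 1%:M + a *: Za) (DZa : D *m Za = 1%:M + a *: Za).
Hypotheses (ZbD : Zb *m D = 1%:M + b *: Zb) (DZb : D *m Zb = 1%:M + b *: Zb).
Hypotheses (SZa : S *m Za = Za *m S) (SZb : S *m Zb = Zb *m S).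
(** In the application [S] is the block sign, so [W'] is [W] with its off-diagonal blocks negated,
    and [Y] is the inverse of [W']. *)
Let Y := S *m X *m S.
Let W' := S *m W *m S.

Let YW' : Y *m W' = 1%:M.
Proof.
rewrite /Y /W' -!mulmxA [S *m (S *m _)]mulmxA SS mul1mx.
by rewrite [X *m (W *m _)]mulmxA XW mul1mx.
Qed.

Let W'Y : W' *m Y = 1%:M.
Proof.
rewrite /Y /W' -!mulmxA [S *m (S *m _)]mulmxA SS mul1mx.
by rewrite [W *m (X *m _)]mulmxA WX mul1mx.
Qed.

(** The same relation as for [W] with [E] negated, so that the results on [X] transfer to [Y]. *)
Let comm_DW' : D *m W' - W' *m D = - E *m C.
Proof.
have -> : - E *m C = S *m (E *m C) *m S.
  rewrite -[RHS]mulmxA -[E *m C *m S]mulmxA CS mulmxN mulmxN !mulmxA SE.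
  by rewrite -[E *m s *m s]mulmxA ss mulmx1 mulNmx.
by rewrite -comm_DW mulmxBr mulmxBl /W' !mulmxA SD -[_ *m D *m S]mulmxA -SD !mulmxA.
Qed.

Let XY2 : X + Y = 2%:R *: (X *m Y).
Proof.
have : X *m (W + W') *m Y = Y + X.
  by rewrite mulmxDr mulmxDl XW mul1mx -mulmxA W'Y mulmx1.
by rewrite SWS -scalemxAr -scalemxAl mulmx1 => ->; rewrite addrC.
Qed.

Let YX2 : X + Y = 2%:R *: (Y *m X).
Proof.
have : Y *m (W + W') *m X = Y + X.
  by rewrite mulmxDr mulmxDl YW' mul1mx -mulmxA WX mulmx1.
by rewrite SWS -scalemxAr -scalemxAl mulmx1 => ->; rewrite addrC.
Qed.

Let trYZ Z : S *m Z = Z *m S -> \tr (Y *m Z) = \tr (X *m Z).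
Proof.
move=> SZ; rewrite /Y -mulmxA SZ mulmxA mxtrace_mulC !mulmxA SS mul1mx.
by [].
Qed.

Let tr_cycY c Z : Z *m D = 1%:M + c *: Z -> D *m Z = 1%:M + c *: Z ->
  \tr (C *m Y *m Z *m Y *m E) = 0.
Proof.
move=> ZD DZ; have := trace_comm_inv comm_DW' YW' W'Y ZD DZ.
by rewrite mulmxN raddfN => /eqP; rewrite oppr_eq0 => /eqP.
Qed.

Let comm_ZW c Z : Z *m D = 1%:M + c *: Z -> D *m Z = 1%:M + c *: Z ->
  Z *m E *m C *m Z = W *m Z - Z *m W.
Proof.
move=> ZD DZ; rewrite -[Z *m E *m C]mulmxA -comm_DW mulmxBr mulmxBl !mulmxA ZD.
by rewrite -[_ *m D *m Z]mulmxA DZ; mxlin.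
Qed.

(** In [Y (W Z - Z W) X], writing the first [W] as [2 - W'] lets [Y] absorb [W'], while [X] absorbs
    the second [W]. *)
Let YZX c Z : Z *m D = 1%:M + c *: Z -> D *m Z = 1%:M + c *: Z ->
  2%:R *: (Y *m Z *m X) = Y *m Z + Z *m X + Y *m (Z *m E *m C *m Z) *m X.
Proof.
move=> ZD DZ; rewrite (comm_ZW ZD DZ).
have -> : W *m Z = 2%:R *: Z - W' *m Z.
  by rewrite -[W](addrK W') SWS mulmxBl -scalemxAl mul1mx.
rewrite mulmxBr mulmxBr !mulmxBl [Y *m (W' *m Z)]mulmxA YW' mul1mx.
rewrite [Y *m (Z *m W)]mulmxA -[_ *m W *m X]mulmxA WX mulmx1.
by move: (Y) => y; mxlin.
Qed.

Let XZY c Z : Z *m D = 1%:M + c *: Z -> D *m Z = 1%:M + c *: Z ->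
  2%:R *: (X *m Z *m Y) = X *m Z + Z *m Y - X *m (Z *m E *m C *m Z) *m Y.
Proof.
move=> ZD DZ; rewrite (comm_ZW ZD DZ).
have -> : Z *m W = 2%:R *: Z - Z *m W'.
  by rewrite -{1}[W](addrK W') SWS mulmxBr -scalemxAr mulmx1.
rewrite mulmxBr mulmxBr !mulmxBl [X *m (W *m Z)]mulmxA XW mul1mx.
rewrite [X *m (Z *m W')]mulmxA -[_ *m W' *m Y]mulmxA W'Y mulmx1.
by move: (Y) => y; mxlin.
Qed.

Let Psi := monodromy.
Let Phi := monodromyV.

Let CYZE Z : S *m Z = Z *m S -> 1%:M + C *m Y *m Z *m E = s *m Psi Z *m s.
Proof.
move=> SZ; rewrite /Psi /monodromy mulmxBr mulmxBl mulmx1 ss /Y !mulmxA CS.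
by rewrite -[_ *m S *m Z]mulmxA SZ -!mulmxA SE !mulNmx !mulmxA.
Qed.

Let CZYE Z : S *m Z = Z *m S -> 1%:M - C *m Z *m Y *m E = s *m Phi Z *m s.
Proof.
move=> SZ; rewrite /Phi /monodromyV mulmxDr mulmxDl mulmx1 ss /Y !mulmxA.
by rewrite -[C *m Z *m S]mulmxA -SZ mulmxA CS -!mulmxA SE !mulNmx opprK !mulmxA.
Qed.

(** Between [C] and [E], the three terms of [YZX] are the product of [1 + C Y Zb E] and
    [1 + C Zb X E] with the leading 1 removed. *)
Let CYZXE : 2%:R *: (C *m Y *m Zb *m X *m E) = s *m Psi Zb *m s *m Phi Zb - 1%:M.
Proof.
have -> : C *m Y *m Zb *m X *m E = C *m (Y *m Zb *m X) *m E by rewrite !mulmxA.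
rewrite scalemxAl scalemxAr (YZX ZbD DZb) -(CYZE SZb) /Phi /monodromyV.
by move: (Y) => y; mxlin.
Qed.

Let CXZYE : 2%:R *: (C *m X *m Za *m Y *m E) = 1%:M - Psi Za *m (s *m Phi Za *m s).
Proof.
have -> : C *m X *m Za *m Y *m E = C *m (X *m Za *m Y) *m E by rewrite !mulmxA.
rewrite scalemxAl scalemxAr (XZY ZaD DZa) -(CZYE SZa) /Psi /monodromy.
by move: (Y) => y; mxlin.
Qed.

(* With [Y := S X S] one has [X + Y = 2 X Y], which turns every product
   [X Z Y] into resolvents and hence the trace into monodromy matrices. *)
Lemma resolvent_pair_trace :
  4%:R * (a - b) ^+ 2 * (\tr (X *m Za *m Zb) - \tr (X *m S *m Za *m X *m S *m Zb))
  = \tr (s *m monodromy Zb *m s *m monodromyV Zb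
         *m monodromy Za *m s *m monodromyV Za *m s) - 2%:R.
Proof.
have -> : X *m S *m Za *m X *m S *m Zb = X *m (Za *m Y *m Zb).
  by rewrite /Y -[X *m S *m Za]mulmxA SZa !mulmxA.
(* The first resolvent identity. *)
have ZaZb : (a - b) *: (Za *m Zb) = Za - Zb.
  have : Za *m D *m Zb = Za *m (D *m Zb) by rewrite mulmxA.
  rewrite ZaD DZb => H; apply/eqP; rewrite -subr_eq0; apply/eqP.
  transitivity ((1%:M + a *: Za) *m Zb - Za *m (1%:M + b *: Zb)); first by mxlin.
  by rewrite H subrr.
(* [2 X Y = X + Y], and [X Z], [Y Z] have equal traces because [S] commutes with [Z]. *)
have trX Z : S *m Z = Z *m S -> \tr (X *m Y *m Z) = \tr (X *m Z).
  move=> SZ; apply: (@mulfI K 2%:R); first by rewrite pnatr_eq0.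
  rewrite -[LHS]mxtraceZ scalemxAl -XY2 mulmxDl raddfD /= (trYZ SZ).
  by ring.
have trX' Z : S *m Z = Z *m S -> \tr (X *m (Z *m Y)) = \tr (X *m Z).
  move=> SZ; rewrite mulmxA mxtrace_mulC mulmxA.
  apply: (@mulfI K 2%:R); first by rewrite pnatr_eq0.
  rewrite -[LHS]mxtraceZ scalemxAl -YX2 mulmxDl raddfD /= (trYZ SZ).
  by ring.
(* One factor [a - b] is consumed by the resolvent identities for [Za Zb] and [Za Y Zb]. The linear
   traces cancel and only the term through [E C] survives. *)
have step1 : (a - b) * (\tr (X *m Za *m Zb) - \tr (X *m (Za *m Y *m Zb))) =
    - \tr (C *m Y *m (Zb *m X *m Za) *m Y *m E).
  rewrite mulrBr -!mxtraceZ -[X *m Za *m Zb]mulmxA 2!(scalemxAr _ X) ZaZb.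
  have := resolvent_inv comm_DW' YW' W'Y ZaD DZb.
  rewrite !mulmxN !mulNmx => HY.
  have -> : (a - b) *: (Za *m Y *m Zb) = Za *m Y - Y *m Zb + Za *m Y *m E *m C *m Y *m Zb.
    by rewrite -[Za *m Y *m E *m C *m Y *m Zb]opprK HY opprB [RHS]addrC subrK.
  rewrite !mulmxDr !mulmxN !raddfD !raddfN /= (trX' _ SZa).
  rewrite [X *m (Y *m Zb)]mulmxA (trX _ SZb).
  have -> : \tr (X *m (Za *m Y *m E *m C *m Y *m Zb)) =
      \tr (C *m Y *m (Zb *m X *m Za) *m Y *m E).
    have -> : X *m (Za *m Y *m E *m C *m Y *m Zb) =
      (X *m Za *m Y *m E) *m (C *m Y *m Zb) by rewrite !mulmxA.
    by rewrite mxtrace_mulC !mulmxA.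
  by ring.
(* The second factor [a - b] is consumed inside that term, now with [X] and the points exchanged. *)
have step2 : - ((a - b) *: (Zb *m X *m Za)) =
    Zb *m X - X *m Za - Zb *m X *m E *m C *m X *m Za.
  have := resolvent_inv comm_DW XW WX ZbD DZa => ->.
  by rewrite opprB [RHS]addrC subrK -scaleNr opprB.
have -> : 4%:R * (a - b) ^+ 2 * (\tr (X *m Za *m Zb) - \tr (X *m (Za *m Y *m Zb))) =
    4%:R * \tr (C *m Y *m (- ((a - b) *: (Zb *m X *m Za))) *m Y *m E).
  rewrite expr2 -!mulrA step1 !(mulmxN, mulNmx) -scalemxAr -!scalemxAl raddfN /= mxtraceZ.
  by rewrite mulrN.
rewrite step2.
set P := s *m Psi Zb *m s *m Phi Zb.
set Q := Psi Za *m (s *m Phi Za *m s).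
have -> : s *m monodromy Zb *m s *m monodromyV Zb
         *m monodromy Za *m s *m monodromyV Za *m s = P *m Q by rewrite /P /Q !mulmxA.
(* Replacing [2 X Y] by [X + Y] leaves two terms; the one with [Y] twice is traceless by
   [tr_cycY]. *)
have t1 : 4%:R * \tr (C *m Y *m Zb *m X *m Y *m E) = \tr (P - 1%:M).
  rewrite -CYZXE mxtraceZ -[4%:R]/((2 * 2)%:R) natrM -mulrA -mxtraceZ; congr (_ * _).
  have -> : C *m Y *m Zb *m X *m Y *m E = C *m Y *m Zb *m (X *m Y) *m E by rewrite !mulmxA.
  rewrite scalemxAl scalemxAr -XY2 mulmxDr mulmxDl raddfD /=.
  by rewrite (tr_cycY ZbD DZb) addr0.
have t2 : 4%:R * \tr (C *m Y *m X *m Za *m Y *m E) = \tr (1%:M - Q).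
  rewrite -CXZYE mxtraceZ -[4%:R]/((2 * 2)%:R) natrM -mulrA -mxtraceZ; congr (_ * _).
  have -> : C *m Y *m X *m Za *m Y *m E = C *m (Y *m X) *m Za *m Y *m E by rewrite !mulmxA.
  rewrite 3!scalemxAl scalemxAr -YX2 mulmxDr !mulmxDl raddfD /=.
  by rewrite (tr_cycY ZaD DZa) addr0.
have t3 : 4%:R * \tr (C *m Y *m Zb *m X *m E *m C *m X *m Za *m Y *m E) =
    \tr ((P - 1%:M) *m (1%:M - Q)).
  rewrite -CYZXE -CXZYE -scalemxAl -scalemxAr !mxtraceZ mulrA -natrM.
  by rewrite !mulmxA.
have -> : C *m Y *m (Zb *m X - X *m Za - Zb *m X *m E *m C *m X *m Za) *m Y *m E =
    C *m Y *m Zb *m X *m Y *m E - C *m Y *m X *m Za *m Y *m E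
    - C *m Y *m Zb *m X *m E *m C *m X *m Za *m Y *m E.
  by move: (Y) => y; mxlin.
(* [(P - 1) - (1 - Q) - (P - 1) (1 - Q) = P Q - 1], and the unit matrix has trace 2. *)
rewrite !raddfB /= !mulrBr t1 t2 t3 !mulmxBl !mulmxBr !mul1mx !mulmx1 !raddfB /=.
rewrite !mxtrace1.
by ring.
Qed.

End Grading.
End Monodromy.

(** * The four-point identity *)

Lemma ord2P (i : 'I_2) : i = 0 \/ i = 1.
Proof. by case: i => [[|[|//]] ?]; [left|right]; apply: val_inj. Qed.

Section SmallMatrices.
Variable K : comNzRingType.

Definition mx2 (a b c d : K) : 'M[K]_2 :=
  \matrix_(i, j) (if i == 0 then if j == 0 then a else b
                  else if j == 0 then c else d).

Lemma mx2_eta (P : 'M[K]_2) : P = mx2 (P 0 0) (P 0 1) (P 1 0) (P 1 1).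
Proof.
by apply/matrixP => i j; rewrite !mxE; case: (ord2P i) => ->; case: (ord2P j) => ->.
Qed.

Lemma mul_mx2 a b c d a' b' c' d' :
  mx2 a b c d *m mx2 a' b' c' d' =
  mx2 (a * a' + b * c') (a * b' + b * d') (c * a' + d * c') (c * b' + d * d').
Proof.
apply/matrixP => i j; rewrite !mxE !big_ord_recl big_ord0 !mxE addr0 /=.
by case: (ord2P i) => ->; case: (ord2P j) => ->.
Qed.

Lemma mxtrace_mx2 a b c d : \tr (mx2 a b c d) = a + d.
Proof. by rewrite /mxtrace !big_ord_recl big_ord0 !mxE addr0. Qed.

Lemma det_mx2 a b c d : \det (mx2 a b c d) = a * d - b * c.
Proof.
rewrite (expand_det_row _ 0) !big_ord_recl big_ord0 /cofactor !det_mx11 !mxE /=.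
by rewrite /bump /=; ring.
Qed.

Lemma mx2_leftinv a b c d (Q : 'M[K]_2) :
  a * d - b * c = 1 -> Q *m mx2 a b c d = 1%:M -> Q = mx2 d (- b) (- c) a.
Proof.
move=> det1 QP.
have PV : mx2 a b c d *m mx2 d (- b) (- c) a = 1%:M.
  rewrite mul_mx2 [RHS]mx2_eta !mxE /= -det1.
  by congr mx2; ring.
by rewrite -[Q]mulmx1 -PV mulmxA QP mul1mx.
Qed.

(** The entries are indexed by [nat] so that the lifted ordinals of the expansion compute to
    numerals. *)
Lemma det_mx4 (f : nat -> nat -> K) :
  \det (\matrix_(i < 4, j < 4) f i j) =
  f 0 0 * (f 1 1 * (f 2 2 * f 3 3 - f 2 3 * f 3 2)
         - f 1 2 * (f 2 1 * f 3 3 - f 2 3 * f 3 1)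
         + f 1 3 * (f 2 1 * f 3 2 - f 2 2 * f 3 1))
  - f 0 1 * (f 1 0 * (f 2 2 * f 3 3 - f 2 3 * f 3 2)
         - f 1 2 * (f 2 0 * f 3 3 - f 2 3 * f 3 0)
         + f 1 3 * (f 2 0 * f 3 2 - f 2 2 * f 3 0))
  + f 0 2 * (f 1 0 * (f 2 1 * f 3 3 - f 2 3 * f 3 1)
         - f 1 1 * (f 2 0 * f 3 3 - f 2 3 * f 3 0)
         + f 1 3 * (f 2 0 * f 3 1 - f 2 1 * f 3 0))
  - f 0 3 * (f 1 0 * (f 2 1 * f 3 2 - f 2 2 * f 3 1)
         - f 1 1 * (f 2 0 * f 3 2 - f 2 2 * f 3 0)
         + f 1 2 * (f 2 0 * f 3 1 - f 2 1 * f 3 0)) :> K.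
Proof.
do 3! rewrite !(expand_det_row _ 0) !big_ord_recl !big_ord0 /cofactor.
by rewrite !det_mx11 !mxE /= /bump /=; ring.
Qed.

(** The 4 x 4 determinant of [det_two_shifts] for diagonal [L1] and [L2]: each column is a 2-vector
    stacked on its multiple by the point attached to it. *)
Definition wronskian4 (p1 q1 r1 t1 p2 q2 r2 t2 a1 b1 a2 b2 : K) : K :=
  \det (block_mx (mx2 p1 q1 r1 t1) (mx2 p2 q2 r2 t2)
    (mx2 p1 q1 r1 t1 *m mx2 a1 0 0 b1) (mx2 p2 q2 r2 t2 *m mx2 a2 0 0 b2)).

(** This is the Laplace expansion along the upper two rows: one term for each of the three
    splittings of the columns into two pairs. *)
Lemma wronskian4E p1 q1 r1 t1 p2 q2 r2 t2 a1 b1 a2 b2 :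
  wronskian4 p1 q1 r1 t1 p2 q2 r2 t2 a1 b1 a2 b2 =
  (p1 * t1 - q1 * r1) * (p2 * t2 - q2 * r2) * (a2 * b2 + a1 * b1)
  - (p1 * r2 - p2 * r1) * (q1 * t2 - q2 * t1) * (b1 * b2 + a1 * a2)
  + (p1 * t2 - q2 * r1) * (q1 * r2 - p2 * t1) * (b1 * a2 + a1 * b2).
Proof.
rewrite /wronskian4 !mul_mx2.
set f := fun i j : nat => nth 0 (nth [::]
  [:: [:: p1; q1; p2; q2]; [:: r1; t1; r2; t2];
      [:: p1 * a1; q1 * b1; p2 * a2; q2 * b2]; [:: r1 * a1; t1 * b1; r2 * a2; t2 * b2]] i) j.
have -> : block_mx (mx2 p1 q1 r1 t1) (mx2 p2 q2 r2 t2)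
    (mx2 (p1 * a1 + q1 * 0) (p1 * 0 + q1 * b1) (r1 * a1 + t1 * 0) (r1 * 0 + t1 * b1))
    (mx2 (p2 * a2 + q2 * 0) (p2 * 0 + q2 * b2) (r2 * a2 + t2 * 0) (r2 * 0 + t2 * b2))
   = \matrix_(i < 4, j < 4) f i j :> 'M[K]_(2 + 2).
  apply/matrixP => i j; rewrite [RHS]mxE !mulr0 !add0r !addr0.
  case: (@split_ordP 2 2 i) => i' ->; case: (@split_ordP 2 2 j) => j' ->;
    rewrite ?(block_mxEul, block_mxEur, block_mxEdl, block_mxEdr) !mxE;
    by case: (ord2P i') => ->; case: (ord2P j') => ->.
rewrite det_mx4 /f /=; ring.
Qed.

End SmallMatrices.

(** The indices 1, 2, 3, 4 belong to the points [l], [- l], [m], [- m]. The first product on the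
    left comes from the steps in [n1], the second from those in [n2]; [pr] is the product of the
    diagonal entries of an inverse matrix times another matrix. *)
Lemma four_point_identity (K : comNzRingType)
    (l m p1 q1 r1 t1 p2 q2 r2 t2 p3 q3 r3 t3 p4 q4 r4 t4 : K) :
    p1 * t1 - q1 * r1 = 1 -> p2 * t2 - q2 * r2 = 1 ->
    p3 * t3 - q3 * r3 = 1 -> p4 * t4 - q4 * r4 = 1 ->
  let pr p q r t p' q' r' t' := (p * t' - q' * r) * (p' * t - q * r') in
  wronskian4 p1 q2 r1 t2 p4 q3 r4 t3 l (- l) (- m) m
  * wronskian4 p2 q1 r2 t1 p3 q4 r3 t4 (- l) l m (- m)
  - wronskian4 p1 q2 r1 t2 p3 q4 r3 t4 l (- l) m (- m)
  * wronskian4 p2 q1 r2 t1 p4 q3 r4 t3 (- l) l (- m) m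
  = 4%:R * l * m * ((l + m) ^+ 2 * (pr p1 q1 r1 t1 p3 q3 r3 t3
                                  + pr p2 q2 r2 t2 p4 q4 r4 t4 - 2%:R)
                  + (l - m) ^+ 2 * (pr p1 q1 r1 t1 p4 q4 r4 t4
                                  + pr p2 q2 r2 t2 p3 q3 r3 t3 - 2%:R))
    + 8%:R * l * m * (l ^+ 2 + m ^+ 2).
Proof.
move=> d1 d2 d3 d4 /=; rewrite !wronskian4E.
(* Multiplying by the unit determinants makes both sides homogeneous, hence equal
   as polynomials. *)
set d := (p1 * t1 - q1 * r1) * (p2 * t2 - q2 * r2)
       * (p3 * t3 - q3 * r3) * (p4 * t4 - q4 * r4).
transitivity (4%:R * l * m *
  ((l + m) ^+ 2 * ((p1 * t3 - q3 * r1) * (p3 * t1 - q1 * r3)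
      * (p2 * t2 - q2 * r2) * (p4 * t4 - q4 * r4)
    + (p2 * t4 - q4 * r2) * (p4 * t2 - q2 * r4)
      * (p1 * t1 - q1 * r1) * (p3 * t3 - q3 * r3) - 2%:R * d)
  + (l - m) ^+ 2 * ((p1 * t4 - q4 * r1) * (p4 * t1 - q1 * r4)
      * (p2 * t2 - q2 * r2) * (p3 * t3 - q3 * r3)
    + (p2 * t3 - q3 * r2) * (p3 * t2 - q2 * r3)
      * (p1 * t1 - q1 * r1) * (p4 * t4 - q4 * r4) - 2%:R * d))
  + 8%:R * l * m * (l ^+ 2 + m ^+ 2) * d).
  rewrite /d; ring.
by rewrite /d d1 d2 d3 d4 !mulr1.
Qed.

(** * Cauchy matrices *)

Lemma sum_ord2 (V : nmodType) (F : 'I_2 -> V) : \sum_i F i = F 0 + F 1.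
Proof. by rewrite !big_ord_recl big_ord0 addr0; congr (_ + F _); apply: val_inj. Qed.

Section Resolvent.
Variables (K : fieldType) (m : nat) (z : 'rV[K]_m).

Definition resolvent (a : K) : 'rV[K]_m := \row_i (z 0 i - a)^-1.
(** The resolvent applied to [E] with a separate point for each column; [diag_mixedU] is the
    Sylvester equation that [det_two_shifts] asks for. *)
Definition mixedU (E : 'M[K]_(m, 2)) (a b : K) : 'M[K]_(m, 2) :=
  \matrix_(i, j) (E i j / (z 0 i - (if j == 0 then a else b))).

Lemma diag_resolvent a : (forall i, z 0 i - a != 0) ->
  diag_mx (resolvent a) *m diag_mx z = 1%:M + a *: diag_mx (resolvent a).
Proof.
move=> ha; rewrite mulmx_diag; apply/matrixP => i j; rewrite !mxE.
case: eqVneq => [->|_]; rewrite ?mulr1n ?mulr0n; last by ring.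
by have h := ha j; field.
Qed.

Lemma resolvent_diag a : (forall i, z 0 i - a != 0) ->
  diag_mx z *m diag_mx (resolvent a) = 1%:M + a *: diag_mx (resolvent a).
Proof. by move=> ha; rewrite diag_mx_comm diag_resolvent. Qed.

Lemma diag_mixedU E a b :
  (forall i, z 0 i - a != 0) -> (forall i, z 0 i - b != 0) ->
  diag_mx z *m mixedU E a b = E + mixedU E a b *m mx2 a 0 0 b.
Proof.
move=> ha hb; apply/matrixP => i j; rewrite mul_diag_mx !mxE !sum_ord2 !mxE /=.
have hza := ha i; have hzb := hb i.
by case: (ord2P j) => -> /=; field; rewrite hza hzb.
Qed.

Lemma two_shifts_entry (W : 'M[K]_m) E (C : 'M[K]_(2, m)) a1 a2 b1 b2 ta tb i j :
  (W - mixedU E a1 b1 *m (mx2 ta 0 0 tb *m (C *m diag_mx z - mx2 a2 0 0 b2 *m C))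
     - mixedU E a2 b2 *m (- (mx2 ta 0 0 tb *m (C *m diag_mx z - mx2 a1 0 0 b1 *m C)))) i j
  = W i j
    - (E i 0 / (z 0 i - a1) * (ta * (C 0 j * (z 0 j - a2)))
     + E i 1 / (z 0 i - b1) * (tb * (C 1 j * (z 0 j - b2))))
    + (E i 0 / (z 0 i - a2) * (ta * (C 0 j * (z 0 j - a1)))
     + E i 1 / (z 0 i - b2) * (tb * (C 1 j * (z 0 j - b1)))).
Proof.
have r a b k : (mx2 ta 0 0 tb *m (C *m diag_mx z - mx2 a 0 0 b *m C)) k j =
    if k == 0 then ta * (C 0 j * (z 0 j - a)) else tb * (C 1 j * (z 0 j - b)).
  have -> : mx2 a 0 0 b *m C = \matrix_(i, j) ((if i == 0 then a else b) * C i j).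
    apply/matrixP => k' j'; rewrite !mxE !sum_ord2 !mxE /=.
    by case: (ord2P k') => -> /=; ring.
  rewrite mul_mx_diag mxE !sum_ord2 !mxE /=.
  by case: (ord2P k) => -> /=; ring.
rewrite mulmxN opprK 2!mxE; congr (_ + _).
  by congr (_ + _); rewrite mxE; congr (- _); rewrite mxE !sum_ord2 !r !mxE.
by rewrite mxE !sum_ord2 !r !mxE.
Qed.

End Resolvent.

(** * Block Cauchy matrices and their shifts *)

Section Cauchy.
Variables (K : numFieldType) (N : nat) (M Mb : 'I_N -> K).
Hypothesis hMM : forall j k, Mb j != M k.

Definition cauchyW (e eb : 'I_N -> K) : 'M[K]_(N + N) :=
  block_mx 1%:M (\matrix_(j, k) (e k / (Mb j - M k)))
           (- \matrix_(j, k) (eb k / (M j - Mb k))) 1%:M.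

Definition spectrum : 'rV[K]_(N + N) := row_mx (\row_j Mb j) (\row_j M j).
Definition cauchyE : 'M[K]_(N + N, 2) :=
  col_mx (\matrix_(i, j) (j == 0)%:R) (\matrix_(i, j) (j == 1)%:R).
Definition cauchyC (e eb : 'I_N -> K) : 'M[K]_(2, N + N) :=
  row_mx (\matrix_(i, k) (if i == 0 then 0 else - eb k))
         (\matrix_(i, k) (if i == 0 then e k else 0)).
Definition grading : 'rV[K]_(N + N) := row_mx (const_mx (- 1)) (const_mx 1).
Let subM j k : Mb j - M k != 0. Proof. by rewrite subr_eq0. Qed.
Let subMb j k : M j - Mb k != 0. Proof. by rewrite subr_eq0 eq_sym. Qed.

Lemma spectrum_neq a i : (forall j, M j != a /\ Mb j != a) -> spectrum 0 i - a != 0.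
Proof.
move=> ha; rewrite subr_eq0; case: (split_ordP i) => j ->;
by rewrite ?row_mxEl ?row_mxEr mxE; case: (ha j).
Qed.

Ltac blk := rewrite ?(block_mxEul, block_mxEur, block_mxEdl, block_mxEdr,
  row_mxEl, row_mxEr, col_mxEu, col_mxEd).

(** The commutator multiplies each off-diagonal entry by its Cauchy denominator, leaving a numerator
    that depends on the column alone; the unit blocks drop out. *)
Lemma cauchy_comm e eb :
  diag_mx spectrum *m cauchyW e eb - cauchyW e eb *m diag_mx spectrum
  = cauchyE *m cauchyC e eb.
Proof.
apply/matrixP => i j; rewrite mul_diag_mx mul_mx_diag !mxE !sum_ord2.
case: (split_ordP i) => i' ->; case: (split_ordP j) => j' ->;
  rewrite /cauchyW /cauchyE /cauchyC /spectrum; blk; rewrite !mxE /=.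
- by case: eqVneq => [->|_] /=; ring.
- by field.
- by field.
- by case: eqVneq => [->|_] /=; ring.
Qed.

Lemma grading_cauchyW e eb :
  cauchyW e eb + diag_mx grading *m cauchyW e eb *m diag_mx grading = 2%:R *: 1%:M.
Proof.
apply/matrixP => i j; rewrite mul_diag_mx mul_mx_diag !mxE.
case: (split_ordP i) => i' ->; case: (split_ordP j) => j' ->;
  rewrite /cauchyW /grading; blk; rewrite !mxE ?eq_lshift ?eq_rshift ?eq_lrshift ?eq_rlshift /=; ring.
Qed.

Lemma grading_grading : diag_mx grading *m diag_mx grading = 1%:M.
Proof.
rewrite mulmx_diag; apply/matrixP => i j; rewrite mxE [X in X *+ _]mxE [RHS]mxE; congr (_ *+ _).
by case: (split_ordP i) => i' ->; rewrite /grading; blk; rewrite !mxE; ring.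
Qed.

Lemma grading_cauchyE : diag_mx grading *m cauchyE = cauchyE *m mx2 (- 1) 0 0 1.
Proof.
apply/matrixP => i j; rewrite mul_diag_mx mxE [RHS]mxE sum_ord2.
case: (split_ordP i) => i' ->; case: (ord2P j) => ->;
  by rewrite /grading /cauchyE; blk; rewrite !mxE /=; ring.
Qed.

Lemma cauchyC_grading e eb :
  cauchyC e eb *m diag_mx grading = - (mx2 (- 1) 0 0 1 *m cauchyC e eb).
Proof.
apply/matrixP => i j; rewrite mul_mx_diag mxE [RHS]mxE [X in - X]mxE sum_ord2.
case: (split_ordP j) => j' ->; case: (ord2P i) => ->;
  by rewrite /grading /cauchyC; blk; rewrite !mxE /=; ring.
Qed.

(** A Miwa shift: multiplication by a rational function at [M], and in [miwa_shiftb] by its inverse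
    at [Mb]. *)
Definition miwa_shift a1 a2 b1 b2 (e : 'I_N -> K) k :=
  e k * ((M k - a1) * (M k - a2)) / ((M k - b1) * (M k - b2)).
Definition miwa_shiftb a1 a2 b1 b2 (eb : 'I_N -> K) k :=
  eb k * ((Mb k - b1) * (Mb k - b2)) / ((Mb k - a1) * (Mb k - a2)).

(** Entrywise this is the partial fraction expansion of [(M - a1)(M - a2) / ((Mb - a1)(Mb - a2)(Mb -
    M))] in [Mb], and its barred analogue with [b1], [b2]: the pole at [M] gives back [W], the other
    poles give the perturbation. *)
Lemma cauchy_shift a1 a2 b1 b2 e eb :
  (forall j, M j != a1 /\ Mb j != a1) -> (forall j, M j != a2 /\ Mb j != a2) ->
  (forall j, M j != b1 /\ Mb j != b1) -> (forall j, M j != b2 /\ Mb j != b2) ->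
  a1 != a2 -> b1 != b2 ->
  let T := mx2 (a1 - a2)^-1 0 0 (b1 - b2)^-1 in
  let CD := cauchyC e eb *m diag_mx spectrum in
  \det (cauchyW (miwa_shift a1 a2 b1 b2 e) (miwa_shiftb a1 a2 b1 b2 eb)) =
  \det (cauchyW e eb
    - mixedU spectrum cauchyE a1 b1 *m (T *m (CD - mx2 a2 0 0 b2 *m cauchyC e eb))
    - mixedU spectrum cauchyE a2 b2 *m (- (T *m (CD - mx2 a1 0 0 b1 *m cauchyC e eb)))).
Proof.
move=> ha1 ha2 hb1 hb2 na nb T CD.
(* Conjugation by [diag_mx kap] turns the shifted matrix into the rank-four perturbation. *)
set kap : 'rV[K]_(N + N) := row_mx (\row_j ((Mb j - a1) * (Mb j - a2)))
                                   (\row_j ((M j - b1) * (M j - b2))).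
have dk : \det (diag_mx kap) != 0.
  rewrite det_diag; apply/prodf_neq0 => i _; rewrite /kap.
  case: (split_ordP i) => j ->; blk; rewrite mxE mulf_neq0 // subr_eq0.
  + by case: (ha1 j).
  + by case: (ha2 j).
  + by case: (hb1 j).
  + by case: (hb2 j).
apply: (mulIf dk); rewrite [RHS]mulrC -!det_mulmx; congr (\det _).
have na' : a1 - a2 != 0 by rewrite subr_eq0.
have nb' : b1 - b2 != 0 by rewrite subr_eq0.
apply/matrixP => i j; rewrite mul_mx_diag mul_diag_mx mxE [RHS]mxE /T /CD two_shifts_entry.
case: (split_ordP i) => i' ->; case: (split_ordP j) => j' ->;
  rewrite /cauchyW /cauchyE /cauchyC /spectrum /kap; blk; rewrite !mxE /= /miwa_shift /miwa_shiftb.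
all: move: (ha1 i') (ha2 i') (hb1 i') (hb2 i') (ha1 j') (ha2 j') (hb1 j') (hb2 j').
all: rewrite -!(subr_eq0 (M _)) -!(subr_eq0 (Mb _)).
all: move=> [? ?] [? ?] [? ?] [? ?] [? ?] [? ?] [? ?] [? ?].
- by case: eqVneq => [->|_] /=; ring.
- by field; rewrite ?subM; do ?[apply/andP; split].
- by field; rewrite ?subMb; do ?[apply/andP; split].
- by case: eqVneq => [->|_] /=; ring.
Qed.

End Cauchy.

(** Evaluates the right-hand side of [resolvent_pair_trace], the inverses being adjugates; inserting
    the unit determinants makes it a homogeneous polynomial identity. *)
Lemma mx2_pair_trace (K : comNzRingType) (p1 q1 r1 t1 p2 q2 r2 t2 : K) :
    p1 * t1 - q1 * r1 = 1 -> p2 * t2 - q2 * r2 = 1 ->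
  \tr (mx2 (- 1) 0 0 1 *m mx2 p2 q2 r2 t2 *m mx2 (- 1) 0 0 1 *m mx2 t2 (- q2) (- r2) p2
       *m mx2 p1 q1 r1 t1 *m mx2 (- 1) 0 0 1 *m mx2 t1 (- q1) (- r1) p1
       *m mx2 (- 1) 0 0 1) - 2%:R
  = 4%:R * ((p1 * t2 - q2 * r1) * (p2 * t1 - q1 * r2) - 1).
Proof.
move=> d1 d2; rewrite !mul_mx2 mxtrace_mx2.
transitivity (4%:R * ((p1 * t2 - q2 * r1) * (p2 * t1 - q1 * r2))
  - 2%:R * (p1 * t1 - q1 * r1) * (p2 * t2 - q2 * r2) - 2%:R); first by ring.
by rewrite d1 d2; ring.
Qed.

(** The four-point identity divided by [(l + m) ^+ 2 * (l - m) ^+ 2]; its last term becomes the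
    difference of the squared ratio and its inverse, since [(l + m) ^+ 4 - (l - m) ^+ 4 = 8 l m (l
    ^+ 2 + m ^+ 2)]. *)
Lemma toda_scalar (K : fieldType) (l m w1 w2 w3 w4 p1 p2 p3 p4 b1 b2 b3 b4 : K) :
    l - m != 0 -> l + m != 0 ->
    w1 * w2 - w3 * w4 = 4%:R * l * m * ((l + m) ^+ 2 * (p1 + p2 - 2%:R)
                                     + (l - m) ^+ 2 * (p3 + p4 - 2%:R))
                        + 8%:R * l * m * (l ^+ 2 + m ^+ 2) ->
    (l - m) ^+ 2 * b1 = p1 - 1 -> (l - - m) ^+ 2 * b2 = p3 - 1 ->
    (- l - m) ^+ 2 * b3 = p4 - 1 -> (- l - - m) ^+ 2 * b4 = p2 - 1 ->
  4%:R * l * m * (b1 + b2 + b3 + b4)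
    + (((l + m) / (l - m)) ^+ 2 - (((l + m) / (l - m)) ^+ 2)^-1) =
  ((l + m) / (l - m)) ^+ 2 * ((l + m)^-1 * (- l - m)^-1 * w1)
    * ((- l - m)^-1 * (l + m)^-1 * w2)
  - (((l + m) / (l - m)) ^+ 2)^-1 * ((l - m)^-1 * (- l + m)^-1 * w3)
    * ((- l + m)^-1 * (l - m)^-1 * w4).
Proof.
move=> n1 n2 id4 h1 h2 h3 h4.
have -> : b1 = (p1 - 1) / (l - m) ^+ 2 by rewrite -h1 mulrAC mulfV ?mul1r // expf_neq0.
have -> : b2 = (p3 - 1) / (l + m) ^+ 2.
  by rewrite -h2 opprK mulrAC mulfV ?mul1r // expf_neq0.
have -> : b3 = (p4 - 1) / (l + m) ^+ 2.
  by rewrite -h3 -opprD sqrrN mulrAC mulfV ?mul1r // expf_neq0.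
have -> : b4 = (p2 - 1) / (l - m) ^+ 2.
  by rewrite -h4 -opprB sqrrN opprK [- m + l]addrC mulrAC mulfV ?mul1r // expf_neq0.
have n3 : - l + m != 0 by rewrite addrC -opprB oppr_eq0.
have n4 : - l - m != 0 by rewrite -opprD oppr_eq0.
transitivity ((w1 * w2 - w3 * w4) / ((l + m) ^+ 2 * (l - m) ^+ 2)).
  by rewrite id4; field; rewrite n1 n2.
by field; rewrite ?n1 ?n2 ?n3 ?n4.
Qed.

(** * The Toda relation for Cauchy matrices *)

Section CauchyToda.
Variables (K : numFieldType) (N : nat) (M Mb : 'I_N -> K).
Hypothesis hMM : forall j k, Mb j != M k.
Variables (e eb : 'I_N -> K).
Local Notation W := (cauchyW M Mb e eb).
Local Notation D := (diag_mx (spectrum M Mb)).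
Local Notation E := (cauchyE K N).
Local Notation C := (cauchyC e eb).
Local Notation X := (invmx W).
Local Notation S := (diag_mx (grading K N)).
Local Notation Z a := (diag_mx (resolvent (spectrum M Mb) a)).
Hypothesis unitW : \det W != 0.

Definition Psi (a : K) : 'M[K]_2 := monodromy X E C (Z a).

Let Wu : W \in unitmx. Proof. by rewrite unitmxE unitfE. Qed.
Let XW : X *m W = 1%:M. Proof. exact: mulVmx. Qed.
Let WX : W *m X = 1%:M. Proof. exact: mulmxV. Qed.

Definition off_spectrum a := forall j, M j != a /\ Mb j != a.

Let ZD a : off_spectrum a -> Z a *m D = 1%:M + a *: Z a.
Proof. by move=> ha; apply: diag_resolvent => i; apply: spectrum_neq. Qed.
Let DZ a : off_spectrum a -> D *m Z a = 1%:M + a *: Z a.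
Proof. by move=> ha; apply: resolvent_diag => i; apply: spectrum_neq. Qed.

Lemma det_Psi a : off_spectrum a ->
  Psi a 0 0 * Psi a 1 1 - Psi a 0 1 * Psi a 1 0 = 1.
Proof.
move=> ha; rewrite -det_mx2 -mx2_eta.
exact: (det_monodromy (cauchy_comm hMM e eb) XW (ZD ha) (DZ ha)).
Qed.

Lemma monodromyV_Psi a : off_spectrum a ->
  monodromyV X E C (Z a) = mx2 (Psi a 1 1) (- Psi a 0 1) (- Psi a 1 0) (Psi a 0 0).
Proof.
move=> ha; apply: mx2_leftinv; first exact: det_Psi.
rewrite -mx2_eta.
exact: (monodromyVK (cauchy_comm hMM e eb) XW WX (ZD ha) (DZ ha)).
Qed.

(** Each column of [mixedU] has its own point, so the result takes one column from each of two
    monodromy matrices. *)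
Lemma Psi_mixedU a b : 1%:M - C *m X *m mixedU (spectrum M Mb) E a b =
  mx2 (Psi a 0 0) (Psi b 0 1) (Psi a 1 0) (Psi b 1 1).
Proof.
rewrite [LHS]mx2_eta /Psi /monodromy -![C *m X *m Z _ *m E]mulmxA.
have CZE c i j : (C *m X *m (Z c *m E)) i j =
    \sum_k (C *m X) i k * (E k j / (spectrum M Mb 0 k - c)).
  rewrite mxE; apply: eq_bigr => k _; congr (_ * _).
  by rewrite mul_diag_mx mxE [X in X * _]mxE mulrC.
have CU i j : (C *m X *m mixedU (spectrum M Mb) E a b) i j =
    \sum_k (C *m X) i k * (E k j / (spectrum M Mb 0 k - (if j == 0 then a else b))).
  by rewrite mxE; apply: eq_bigr => k _; congr (_ * _); rewrite mxE.
by congr mx2; rewrite mxE [in RHS]mxE; congr (_ + _); rewrite mxE [in RHS]mxE;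
  congr (- _); rewrite CZE CU.
Qed.

Lemma det_cauchy_shift a1 a2 b1 b2 :
  off_spectrum a1 -> off_spectrum a2 -> off_spectrum b1 -> off_spectrum b2 ->
  a1 != a2 -> b1 != b2 ->
  \det (cauchyW M Mb (miwa_shift M a1 a2 b1 b2 e) (miwa_shiftb Mb a1 a2 b1 b2 eb)) =
  \det W * ((a1 - a2)^-1 * (b1 - b2)^-1 *
    wronskian4 (Psi a1 0 0) (Psi b1 0 1) (Psi a1 1 0) (Psi b1 1 1)
               (Psi a2 0 0) (Psi b2 0 1) (Psi a2 1 0) (Psi b2 1 1) a1 b1 a2 b2).
Proof.
move=> ha1 ha2 hb1 hb2 na nb; rewrite cauchy_shift //=.
have pn c : off_spectrum c -> forall i, spectrum M Mb 0 i - c != 0 by move=> hc i; apply: spectrum_neq.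
rewrite (det_two_shifts (cauchy_comm hMM e eb) XW WX (L1 := mx2 a1 0 0 b1) (L2 := mx2 a2 0 0 b2)).
- by rewrite !Psi_mixedU det_mx2 mulr0 subr0.
- exact: diag_mixedU (pn _ ha1) (pn _ hb1).
- exact: diag_mixedU (pn _ ha2) (pn _ hb2).
have -> : mx2 a1 0 0 b1 - mx2 a2 0 0 b2 = mx2 (a1 - a2) 0 0 (b1 - b2).
  by rewrite [LHS]mx2_eta !mxE /= !subr0.
rewrite mul_mx2 [RHS]mx2_eta !mxE /= !mulr0 !mul0r !addr0 !add0r.
by rewrite !mulVf // subr_eq0.
Qed.

(* The mixed derivative of [ln (\det W)] along the flows of symbols [1 / (M - a)] and
   [1 / (M - b)]. *)
Definition pairB a b := \tr (X *m Z a *m Z b) - \tr (X *m S *m Z a *m X *m S *m Z b).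

Lemma pairB_Psi a b : off_spectrum a -> off_spectrum b ->
  (a - b) ^+ 2 * pairB a b =
  (Psi a 0 0 * Psi b 1 1 - Psi b 0 1 * Psi a 1 0)
  * (Psi b 0 0 * Psi a 1 1 - Psi a 0 1 * Psi b 1 0) - 1.
Proof.
move=> ha hb.
have ss : mx2 (- 1) 0 0 1 *m mx2 (- 1) 0 0 1 = 1%:M :> 'M[K]_2.
  by rewrite mul_mx2 [RHS]mx2_eta !mxE /=; congr mx2; ring.
have := resolvent_pair_trace (cauchy_comm hMM e eb) XW WX (grading_grading K N) ss
  (diag_mx_comm _ _) (grading_cauchyE K N) (cauchyC_grading e eb) (grading_cauchyW M Mb e eb)
  (ZD ha) (DZ ha) (ZD hb) (DZ hb) (diag_mx_comm _ _) (diag_mx_comm _ _).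
rewrite -/(pairB a b) (monodromyV_Psi ha) (monodromyV_Psi hb) -/(Psi a) -/(Psi b).
have da := det_Psi ha; have db := det_Psi hb.
have eA := mx2_eta (Psi a); have eB := mx2_eta (Psi b).
move: da db eA eB; generalize (pairB a b) (Psi a) (Psi b) => y A B da db eA eB.
rewrite {1}eA {1}eB (mx2_pair_trace da db) => h.
apply: (@mulfI K 4%:R); first by rewrite pnatr_eq0.
by rewrite mulrA h.
Qed.

(** Partial fractions of the generator: [(M - z) / (M + z) - (M + z) / (M - z)] equals [- 2 z] times
    the sum of [1 / (M - z)] and [1 / (M + z)]. The sign [S] accounts for the barred block. *)
Definition Lflow (z : K) := (- 2%:R * z) *: (S *m (Z z + Z (- z))).

Lemma Lflow_pairB (l m : K) :
  \tr (X *m Lflow l *m Lflow m) - \tr (X *m Lflow l *m X *m Lflow m) =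
  4%:R * l * m * (pairB l m + pairB l (- m) + pairB (- l) m + pairB (- l) (- m)).
Proof.
rewrite /Lflow -!scalemxAr -!scalemxAl !mxtraceZ.
have -> : X *m (S *m (Z l + Z (- l))) *m (S *m (Z m + Z (- m))) =
    X *m (Z l + Z (- l)) *m (Z m + Z (- m)).
  have SZ : S *m (Z l + Z (- l)) = (Z l + Z (- l)) *m S.
    by rewrite mulmxDr mulmxDl ![S *m _]diag_mx_comm.
  by rewrite SZ !mulmxA -[_ *m S *m S]mulmxA grading_grading mulmx1.
rewrite !(mulmxDr, mulmxDl) !raddfD /= /pairB !mulmxA; ring.
Qed.

(** The Toda equation at one point, free of derivatives and logarithms: the traces will be the mixed
    derivative of [ln (\det W)], and [r - r^-1] that of [phi]. *)
Lemma cauchy_toda (l m : K) :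
    off_spectrum l -> off_spectrum (- l) -> off_spectrum m -> off_spectrum (- m) ->
    l != m -> l != - m ->
  let r := ((l + m) / (l - m)) ^+ 2 in
  let tau a1 a2 b1 b2 :=
    \det (cauchyW M Mb (miwa_shift M a1 a2 b1 b2 e) (miwa_shiftb Mb a1 a2 b1 b2 eb)) / \det W in
  \tr (X *m Lflow l *m Lflow m) - \tr (X *m Lflow l *m X *m Lflow m) + (r - r^-1) =
  r * tau l (- m) (- l) m * tau (- l) m l (- m)
  - r^-1 * tau l m (- l) (- m) * tau (- l) (- m) l m.
Proof.
move=> hl hl' hm hm' nlm nlm' r tau.
have n1 : l - m != 0 by rewrite subr_eq0.
have n2 : l + m != 0 by rewrite -[m]opprK subr_eq0.
have nlm2 : - l != m by rewrite eqr_oppLR.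
have nlm3 : - l != - m by rewrite eqr_opp.
have tauE a1 a2 b1 b2 :
  off_spectrum a1 -> off_spectrum a2 -> off_spectrum b1 -> off_spectrum b2 ->
  a1 != a2 -> b1 != b2 ->
  tau a1 a2 b1 b2 = (a1 - a2)^-1 * (b1 - b2)^-1 *
    wronskian4 (Psi a1 0 0) (Psi b1 0 1) (Psi a1 1 0) (Psi b1 1 1)
               (Psi a2 0 0) (Psi b2 0 1) (Psi a2 1 0) (Psi b2 1 1) a1 b1 a2 b2.
  by move=> *; rewrite /tau det_cauchy_shift // mulrAC mulfV // mul1r.
rewrite !tauE // Lflow_pairB /r !opprK.
exact: (toda_scalar n1 n2
  (four_point_identity l m (det_Psi hl) (det_Psi hl') (det_Psi hm) (det_Psi hm'))
  (pairB_Psi hl hm) (pairB_Psi hl hm') (pairB_Psi hl' hm) (pairB_Psi hl' hm')).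
Qed.

End CauchyToda.

(** * Derivatives of determinants and inverses *)

Section MatrixDerivatives.
Variable R : realType.
Implicit Types (f g : R -> R) (x : R).

Lemma is_derive_add f g x df dg : is_derive x 1 f df -> is_derive x 1 g dg ->
  is_derive x 1 (fun t => f t + g t) (df + dg).
Proof. by move=> hf hg; exact: is_deriveD. Qed.

Lemma is_derive_mul f g x df dg : is_derive x 1 f df -> is_derive x 1 g dg ->
  is_derive x 1 (fun t => f t * g t) (df * g x + f x * dg).
Proof.
move=> hf hg; apply: (is_derive_eq (is_deriveM hf hg)).
by rewrite addrC; congr (_ + _); rewrite mulrC.
Qed.

Lemma is_derive_mulc f x df c : is_derive x 1 f df ->
  is_derive x 1 (fun t => f t * c) (df * c).
Proof.
move=> hf; apply: (is_derive_eq (is_derive_mul hf (is_derive_cst c x 1))).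
by rewrite mulr0 addr0.
Qed.

Lemma is_derive_cmul f x df c : is_derive x 1 f df ->
  is_derive x 1 (fun t => c * f t) (c * df).
Proof.
move=> hf; apply: (is_derive_eq (is_derive_mul (is_derive_cst c x 1) hf)).
by rewrite mul0r add0r.
Qed.

Lemma is_derive_bigsum (I : Type) (r : seq I) (f : I -> R -> R) (df : I -> R) x :
  (forall i, is_derive x 1 (f i) (df i)) ->
  is_derive x 1 (fun t => \sum_(i <- r) f i t) (\sum_(i <- r) df i).
Proof.
move=> hf; elim: r => [|i r IH].
  under eq_fun do rewrite big_nil.
  by rewrite big_nil; exact: is_derive_cst.
under eq_fun do rewrite big_cons.
by rewrite big_cons; exact: is_derive_add.
Qed.

(** Uniqueness guarantees that the condition [i != k] removes exactly one factor. *)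
Lemma is_derive_bigprod (I : eqType) (r : seq I) (f : I -> R -> R) (df : I -> R) x :
  uniq r -> (forall i, is_derive x 1 (f i) (df i)) ->
  is_derive x 1 (fun t => \prod_(i <- r) f i t)
    (\sum_(k <- r) df k * \prod_(i <- r | i != k) f i x).
Proof.
move=> + hf; elim: r => [_|a r IH /= /andP[ar ur]].
  under eq_fun do rewrite big_nil.
  by rewrite big_nil; exact: is_derive_cst.
under eq_fun do rewrite big_cons.
apply: is_derive_eq; first exact: is_derive_mul (IH ur).
rewrite big_cons big_cons eqxx /=; congr (_ * _ + _).
  rewrite [RHS]big_seq_cond [LHS]big_seq; apply: eq_bigl => i.
  by case: (boolP (i \in r)) => //= ir; apply/esym; apply: contraNneq ar => <-.
rewrite mulr_sumr [LHS]big_seq [RHS]big_seq; apply: eq_bigr => k kr.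
rewrite big_cons; have -> : a != k by apply: contraNneq ar => ->.
by rewrite mulrCA.
Qed.

(** Jacobi's formula: the differentiated Leibniz terms are regrouped by row into the determinants of
    [Wk k], each then expanded along row [k]. *)
Lemma is_derive_det m (W : R -> 'M[R]_m) (dW : 'M[R]_m) x :
  (forall i j, is_derive x 1 (fun t => W t i j) (dW i j)) ->
  is_derive x 1 (fun t => \det (W t)) (\tr (dW *m \adj (W x))).
Proof.
move=> hW; rewrite /determinant.
have h (s : 'S_m) := is_derive_cmul ((-1) ^+ s)
  (is_derive_bigprod (index_enum_uniq _) (fun i => hW i (s i))).
apply: (is_derive_eq (is_derive_bigsum _ h)).
pose Wk k := \matrix_(i, j) (if i == k then dW i j else W x i j).
transitivity (\sum_k \det (Wk k)).
  rewrite exchange_big; apply: eq_bigr => s _; rewrite -mulr_sumr.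
  congr (_ * _); apply: eq_bigr => k _.
  rewrite [RHS](bigD1 k) //= mxE eqxx; congr (_ * _).
  by apply: eq_bigr => i /negPf ik; rewrite mxE ik.
rewrite /mxtrace; apply: eq_bigr => k _; rewrite (expand_det_row _ k) mxE.
apply: eq_bigr => j _; rewrite !mxE eqxx; congr (_ * _).
rewrite /cofactor; congr (_ * \det _); apply/matrixP => i l; rewrite !mxE.
by rewrite eq_sym (negPf (neq_lift _ _)).
Qed.

Section Inverse.
Variables (m : nat) (W : R -> 'M[R]_m) (dW : 'M[R]_m) (x : R).
Hypothesis hW : forall i j, is_derive x 1 (fun t => W t i j) (dW i j).
Hypothesis unitW : forall t, \det (W t) != 0.

Let Wu t : W t \in unitmx. Proof. by rewrite unitmxE unitfE. Qed.

Lemma is_derive_ln_det : (forall t, 0 < \det (W t)) ->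
  is_derive x 1 (fun t => ln (\det (W t))) (\tr (dW *m invmx (W x))).
Proof.
move=> W0; apply: (is_derive_eq (is_derive1_comp (is_derive1_ln (W0 x)) (is_derive_det hW))).
by rewrite /invmx Wu -scalemxAr mxtraceZ.
Qed.

(** Cramer's formula gives differentiability; the value then follows by differentiating
    [W W^-1 = 1]. *)
Lemma is_derive_invmx i j :
  is_derive x 1 (fun t => invmx (W t) i j) (- (invmx (W x) *m dW *m invmx (W x)) i j).
Proof.
pose V i j := 'D_1 (fun t => invmx (W t) i j) x.
have hV k l : is_derive x 1 (fun t => invmx (W t) k l) (V k l).
  apply/derivableP.
  have -> : (fun t => invmx (W t) k l) =
      (fun t => (\det (W t))^-1 * cofactor (W t) l k).
    by apply/funext => t; rewrite /invmx Wu !mxE.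
  apply: derivableM.
    by apply: derivableV => //; case: (is_derive_det hW).
  rewrite /cofactor; apply: derivableM; first exact: derivable_cst.
  have h : forall a b, is_derive x 1 (fun t => (row' l (col' k (W t))) a b)
      (dW (lift l a) (lift k b)).
    by move=> a b; under eq_fun do rewrite !mxE; exact: hW.
  have h' : forall a b, is_derive x 1 (fun t => (row' l (col' k (W t))) a b)
      ((row' l (col' k dW)) a b).
    by move=> a b; rewrite !mxE; exact: h.
  by case: (is_derive_det h').
have key : dW *m invmx (W x) + W x *m (\matrix_(i, j) V i j) = 0.
  apply/matrixP => k l; rewrite !mxE.
  have h1 : is_derive x 1 (fun t => \sum_a W t k a * invmx (W t) a l)
      (\sum_a (dW k a * invmx (W x) a l + W x k a * V a l)).
    by apply: is_derive_bigsum => a; exact: is_derive_mul.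
  have : is_derive x 1 (fun t => \sum_a W t k a * invmx (W t) a l) 0.
    have -> : (fun t => \sum_a W t k a * invmx (W t) a l) = cst ((k == l)%:R).
      apply/funext => t; have := mulmxV (Wu t).
      by move=> /matrixP /(_ k l); rewrite !mxE.
    exact: is_derive_cst.
  move=> [_ h2]; case: h1 => _; rewrite h2 => h3; rewrite [RHS]h3 big_split /=; congr (_ + _).
  by apply: eq_bigr => a _; rewrite mxE.
apply: (is_derive_eq (hV i j)).
have : \matrix_(i, j) V i j = - (invmx (W x) *m dW *m invmx (W x)).
  move/(congr1 (mulmx (invmx (W x)))): key.
  rewrite mulmxDr mulmx0 !mulmxA mulVmx // mul1mx => /eqP.
  by rewrite addrC addr_eq0 => /eqP.
by move=> /matrixP /(_ i j); rewrite !mxE.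
Qed.

End Inverse.

(** * Mixed logarithmic derivative along two diagonal flows *)

Section MixedLogDet.
Variables (m : nat) (W : R -> R -> 'M[R]_m) (p q : 'rV[R]_m).
Hypothesis dWx : forall (x y : R) i j,
  is_derive x 1 (fun t => W t y i j) ((W x y i j - (i == j)%:R) * p 0 j).
Hypothesis dWy : forall (x y : R) i j,
  is_derive y 1 (fun t => W x t i j) ((W x y i j - (i == j)%:R) * q 0 j).
Hypothesis W0 : forall x y, 0 < \det (W x y).

Let unitW x y : \det (W x y) != 0. Proof. by rewrite gt_eqF. Qed.
Let Wu x y : W x y \in unitmx. Proof. by rewrite unitmxE unitfE. Qed.

Let flow x y (r : 'rV[R]_m) i j : (W x y i j - (i == j)%:R) * r 0 j =
  ((W x y - 1%:M) *m diag_mx r) i j.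
Proof. by rewrite mul_mx_diag !mxE. Qed.

Lemma is_derive_ln_det_flow (x y : R) : is_derive y 1 (fun t => ln (\det (W x t)))
  (\tr (diag_mx q) - \tr (invmx (W x y) *m diag_mx q)).
Proof.
have h i j : is_derive y 1 (fun t => W x t i j) (((W x y - 1%:M) *m diag_mx q) i j).
  by rewrite -flow; exact: dWy.
apply: (is_derive_eq (is_derive_ln_det h (unitW x) (W0 x))).
rewrite !mulmxBl mul1mx raddfB /= mxtrace_mulC !mulmxA mulVmx // mul1mx.
by rewrite [\tr (diag_mx q *m _)]mxtrace_mulC.
Qed.

(** Differentiating the inverse along [(W - 1) P] gives the trace of [P X Q] minus that of
    [X P X Q], with [X] the inverse of [W]; the diagonal [P] and [Q] commute. *)
Lemma is_derive_mixed_ln_det (x y : R) :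
  is_derive x 1 (fun t => \tr (diag_mx q) - \tr (invmx (W t y) *m diag_mx q))
   (\tr (invmx (W x y) *m diag_mx p *m diag_mx q)
    - \tr (invmx (W x y) *m diag_mx p *m invmx (W x y) *m diag_mx q)).
Proof.
have h i j : is_derive x 1 (fun t => W t y i j) (((W x y - 1%:M) *m diag_mx p) i j).
  by rewrite -flow; exact: dWx.
have trE X : \tr (X *m diag_mx q) = \sum_i X i i * q 0 i.
  by rewrite mul_mx_diag /mxtrace; apply: eq_bigr => i _; rewrite mxE.
have dtr : is_derive x 1 (fun t => \tr (invmx (W t y) *m diag_mx q))
    (- \tr (invmx (W x y) *m ((W x y - 1%:M) *m diag_mx p) *m invmx (W x y) *m diag_mx q)).
  under eq_fun do rewrite trE.
  have hi i := is_derive_mulc (q 0 i) (is_derive_invmx h (fun t => unitW t y) i i).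
  apply: (is_derive_eq (is_derive_bigsum _ hi)).
  by rewrite trE -sumrN; apply: eq_bigr => i _; rewrite mulNr.
apply: (is_derive_eq (is_deriveB (is_derive_cst _ _ _) dtr)).
rewrite sub0r opprK mulmxBl mul1mx mulmxBr mulmxA mulVmx // mul1mx !mulmxBl raddfB /=.
congr (_ - _); rewrite mxtrace_mulC !mulmxA diag_mx_comm mxtrace_mulC.
by rewrite mulmxA.
Qed.

End MixedLogDet.
End MatrixDerivatives.

(** * The tau function *)

Section DiagonalMatrices.
Import numFieldNormedType.Exports.
Local Open Scope classical_set_scope.
Variables (R : realType) (n : nat).
Implicit Types (d : 'I_n.+1 -> R).

Lemma diagfE d i j : diagf d i j = d i *+ (i == j).
Proof. by rewrite /diagf !mxE. Qed.

Lemma diagfM d d' : diagf d *m diagf d' = @diagf R n (fun j => d j * d' j).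
Proof. by rewrite mulmx_diag; congr diag_mx; apply/rowP => j; rewrite !mxE. Qed.

Lemma diagf_linear (a b : R) d d' :
  a *: diagf d + b *: diagf d' = diagf (fun j => a * d j + b * d' j).
Proof.
by apply/matrixP => i j; rewrite !mxE; case: eqVneq => _; rewrite ?mulr1n ?mulr0n ?mulr0 ?addr0.
Qed.

Lemma diagf_const (z : R) : z%:M = diagf (fun=> z) :> 'M[R]_n.+1.
Proof. by apply/matrixP => i j; rewrite diagfE mxE. Qed.

Lemma diagf_unit d : (forall j, d j != 0) -> diagf d \in unitmx.
Proof.
move=> hd; rewrite unitmxE det_diag unitfE; apply/prodf_neq0 => i _.
by rewrite mxE.
Qed.

Lemma invmx_diagf d : (forall j, d j != 0) -> invmx (diagf d) = diagf (fun j => (d j)^-1).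
Proof.
move=> hd; have du := diagf_unit hd.
rewrite -[RHS]mul1mx -(mulVmx du) -mulmxA diagfM.
have -> : diagf (fun j => d j * (d j)^-1) = 1%:M.
  by rewrite diagf_const; congr diagf; apply/funext => j; rewrite mulfV.
by rewrite mulmx1.
Qed.

Lemma diagfX d k : diagf d ^+ k = diagf (fun j => d j ^+ k).
Proof.
elim: k => [|k IH]; first by rewrite expr0 -[1]/(1%:M) diagf_const.
rewrite exprS IH -[_ * _]/(_ *m _) diagfM.
by congr diagf; apply/funext => j; rewrite exprS.
Qed.

Lemma diagf_exprz d (k : int) : (forall j, d j != 0) ->
  diagf d ^ k = diagf (fun j => d j ^ k).
Proof.
move=> hd; case: k => k; first exact: diagfX.
rewrite NegzE -!exprnN diagfX -[_^-1]/(invmx _) invmx_diagf => [|j].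
  by congr diagf; apply/funext => j; rewrite -exprnN.
exact: expf_neq0.
Qed.

(** Matrix balls are entrywise, and the finitely many scalar exponential series admit a common
    rank. *)
Lemma mexp_diagf d : mexp (diagf d) = diagf (fun j => expR (d j)).
Proof.
pose V : normedModType R := 'M[R]_n.+1.
apply: (@cvg_lim V (@norm_hausdorff R V)).
apply/cvg_ballP => eps eps0.
have h j : \forall k \near \oo, ball (expR (d j)) eps (series (exp_coeff (d j)) k).
  by have /cvg_ballP := @is_cvg_series_exp_coeff _ (d j); exact.
have {}h : \forall k \near \oo, forall j, ball (expR (d j)) eps (series (exp_coeff (d j)) k).
  exact: filter_forall.
apply: filterS h => k hk; split => // i j.
rewrite diagfE.
have -> : series (fun k => (k`!%:R)^-1 *: diagf d ^+ k) k i j =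
    series (exp_coeff (d i)) k *+ (i == j).
  rewrite /series /= summxE -sumrMnl; apply: eq_bigr => l _.
  by rewrite diagfX mxE diagfE /exp_coeff /= mulrnAr mulrC.
case: eqVneq => _; first by rewrite !mulr1n; exact: hk.
by rewrite !mulr0n; exact: ballxx.
Qed.

End DiagonalMatrices.

(** * Scalar form of the exponential and lattice factors *)

Section Factors.
Variables (R : realType) (n : nat) (M Mb : 'I_n.+1 -> R).

Definition hfac (m : 'I_n.+1 -> R) (z : R) j := (m j - z) / (m j + z).
(** Column numerator of an entry of [Amat]; those of [Abmat] arise at the points [- lam] and
    [- mu]. *)
Definition hexp (m a : 'I_n.+1 -> R) (l k x y : R) (n1 n2 : int) j :=
  a j * expR (x * (hfac m l j - (hfac m l j)^-1) + y * (hfac m k j - (hfac m k j)^-1))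
  * hfac m l j ^ (n1 + n2) * hfac m k j ^ (n2 - n1).

Definition regular (m : 'I_n.+1 -> R) (z : R) :=
  forall j, (m j - z != 0) && (m j + z != 0).

Lemma hfac_neq0 m z j : regular m z -> hfac m z j != 0.
Proof. by move=> /(_ j) /andP[h1 h2]; rewrite mulf_neq0 // invr_neq0. Qed.

Lemma HmE m z : regular m z -> Hm m z = diagf (hfac m z).
Proof.
move=> hm; rewrite /Hm diagf_const.
have -> : diagf m - diagf (fun=> z) = diagf (fun j => m j - z).
  rewrite -[diagf m]scale1r -scaleN1r diagf_linear.
  by congr diagf; apply/funext => j; rewrite mul1r mulN1r.
have -> : diagf m + diagf (fun=> z) = diagf (fun j => m j + z).
  rewrite -[diagf m]scale1r -[diagf (fun=> z)]scale1r diagf_linear.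
  by congr diagf; apply/funext => j; rewrite !mul1r.
by rewrite invmx_diagf => [|j]; [exact: diagfM|case/andP: (hm j)].
Qed.

Lemma LmE m z : regular m z ->
  Lm m z = diagf (fun j => hfac m z j - (hfac m z j)^-1).
Proof.
move=> hm; rewrite /Lm HmE // invmx_diagf => [|j]; last exact: hfac_neq0.
rewrite -[diagf (hfac _ _)]scale1r -scaleN1r diagf_linear.
by congr diagf; apply/funext => j; rewrite mul1r mulN1r.
Qed.

(* Hence the barred factors need no separate treatment. *)
Lemma Hbm_Hm z : Hbm Mb z = Hm Mb (- z).
Proof. by rewrite /Hbm /Hm raddfN /= opprK. Qed.

Lemma mul_cauchy_diag (a b d : 'I_n.+1 -> R) m :
  (\matrix_(j, k) (a k / (b j - m k))) *m diagf d = \matrix_(j, k) (a k * d k / (b j - m k)).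
Proof. by rewrite mul_mx_diag; apply/matrixP => j k; rewrite !mxE mulrAC. Qed.

Lemma regularN m z : regular m z -> regular m (- z).
Proof. by move=> h j; rewrite opprK andbC; exact: h. Qed.

Lemma spectral_conditions z :
    (forall j, [/\ z != M j, z != - M j, z != Mb j & z != - Mb j]) ->
  [/\ off_spectrum M Mb z, off_spectrum M Mb (- z), regular M z & regular Mb z].
Proof.
move=> h; split=> j; have [h1 h2 h3 h4] := h j.
- by split; rewrite eq_sym.
- by split; rewrite eq_sym eqr_oppLR.
- by rewrite subr_eq0 eq_sym h1 addr_eq0 -eqr_oppLR eq_sym h2.
- by rewrite subr_eq0 eq_sym h3 addr_eq0 -eqr_oppLR eq_sym h4.
Qed.

Lemma hexp_shift m a l k x y n1 n2 s t j : regular m l -> regular m k ->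
  hexp m a l k x y (n1 + s) (n2 + t) j =
  hexp m a l k x y n1 n2 j * (hfac m l j ^ (s + t) * hfac m k j ^ (t - s)).
Proof.
move=> hl hk; rewrite /hexp.
have -> : n1 + s + (n2 + t) = n1 + n2 + (s + t) by ring.
have -> : n2 + t - (n1 + s) = n2 - n1 + (t - s) by ring.
by rewrite !expfzDr ?hfac_neq0 //; ring.
Qed.

Lemma hfacN m z j : hfac m (- z) j = (m j + z) / (m j - z).
Proof. by rewrite /hfac opprK. Qed.

Lemma regular_neq0 m z j : regular m z -> (m j - z != 0) * (m j + z != 0).
Proof. by move=> /(_ j) /andP[-> ->]. Qed.

Definition flow_row (z : R) : 'rV[R]_(n.+1 + n.+1) :=
  row_mx (\row_j (hfac Mb (- z) j - (hfac Mb (- z) j)^-1))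
         (\row_j (hfac M z j - (hfac M z j)^-1)).

Lemma diag_flow_row z : regular M z -> regular Mb z ->
  diag_mx (flow_row z) = Lflow M Mb z.
Proof.
move=> hM hMb; rewrite /Lflow -raddfD /= mulmx_diag -linearZ /=; congr diag_mx.
apply/rowP => i; transitivity (- 2%:R * z * (grading R n.+1 0 i *
    ((spectrum M Mb 0 i - z)^-1 + (spectrum M Mb 0 i - - z)^-1))); last by rewrite !mxE.
rewrite /flow_row /grading /spectrum.
case: (split_ordP i) => j ->; rewrite ?row_mxEl ?row_mxEr !mxE ?hfacN /hfac opprK ?invf_div;
  by field; rewrite ?(regular_neq0 _ hM) ?(regular_neq0 _ hMb).
Qed.

Lemma is_derive_expR_lin (a b t : R) :
  is_derive t 1 (fun t => expR (t * a + b)) (a * expR (t * a + b)).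
Proof.
have h : is_derive t 1 (fun t => t * a + b) (1 * a + 0).
  exact: (is_derive_add (is_derive_mulc a (is_derive_id t 1)) (is_derive_cst b t 1)).
apply: (is_derive_eq (is_derive1_comp (is_derive_expR _) h)).
by rewrite mul1r addr0 mulrC.
Qed.

Lemma is_derive_hexp_x m a l k (x y : R) n1 n2 j :
  is_derive x 1 (fun t => hexp m a l k t y n1 n2 j)
    (hexp m a l k x y n1 n2 j * (hfac m l j - (hfac m l j)^-1)).
Proof.
rewrite /hexp.
apply: (is_derive_eq (is_derive_mulc _ (is_derive_mulc _ (is_derive_cmul _ (is_derive_expR_lin _ _ _))))).
by ring.
Qed.

Lemma is_derive_hexp_y m a l k (x y : R) n1 n2 j :
  is_derive y 1 (fun t => hexp m a l k x t n1 n2 j)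
    (hexp m a l k x y n1 n2 j * (hfac m k j - (hfac m k j)^-1)).
Proof.
rewrite /hexp; under eq_fun do rewrite addrC.
apply: (is_derive_eq (is_derive_mulc _ (is_derive_mulc _ (is_derive_cmul _ (is_derive_expR_lin _ _ _))))).
by rewrite [y * _ + _]addrC; ring.
Qed.

(** Numerators depend on the column alone, so the flow multiplies columns; subtracting the identity
    accounts for the constant diagonal blocks. *)
Lemma is_derive_cauchyW (e eb : R -> 'I_n.+1 -> R) (a b : 'I_n.+1 -> R) (t : R) i j :
    (forall k, is_derive t 1 (fun s => e s k) (e t k * a k)) ->
    (forall k, is_derive t 1 (fun s => eb s k) (eb t k * b k)) ->
  is_derive t 1 (fun s => cauchyW M Mb (e s) (eb s) i j)
    ((cauchyW M Mb (e t) (eb t) i j - (i == j)%:R)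
     * (row_mx (\row_k b k) (\row_k a k) : 'rV[R]_(n.+1 + n.+1)) 0 j).
Proof.
move=> he heb; case: (split_ordP i) => i' ->; case: (split_ordP j) => j' ->;
  under eq_fun do
    rewrite /cauchyW ?(block_mxEul, block_mxEur, block_mxEdl, block_mxEdr) !mxE;
  rewrite /cauchyW ?(block_mxEul, block_mxEur, block_mxEdl, block_mxEdr)
    ?(row_mxEl, row_mxEr) !mxE ?(eq_lshift, eq_rshift, eq_lrshift, eq_rlshift).
- by rewrite subrr mul0r; exact: is_derive_cst.
- by apply: (is_derive_eq (is_derive_mulc _ (he j'))); rewrite subr0 mulrAC.
- apply: (is_derive_eq (is_deriveN (is_derive_mulc _ (heb j')))).
  by rewrite subr0 mulNr mulrAC.
- by rewrite subrr mul0r; exact: is_derive_cst.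
Qed.

End Factors.

(** * The tau function as a Cauchy determinant and its lattice steps *)

Section Reduction.
Variables (R : realType) (n : nat) (M Mb c cb : 'I_n.+1 -> R) (lam mu : R).
Hypothesis hlamM : forall j, [/\ lam != M j, lam != - M j, lam != Mb j & lam != - Mb j].
Hypothesis hmuM : forall j, [/\ mu != M j, mu != - M j, mu != Mb j & mu != - Mb j].

Let rl : regular M lam. Proof. by case: (spectral_conditions hlamM). Qed.
Let rm : regular M mu. Proof. by case: (spectral_conditions hmuM). Qed.
Let rlb : regular Mb lam. Proof. by case: (spectral_conditions hlamM). Qed.
Let rmb : regular Mb mu. Proof. by case: (spectral_conditions hmuM). Qed.
Let rlN : regular Mb (- lam). Proof. exact: regularN. Qed.
Let rmN : regular Mb (- mu). Proof. exact: regularN. Qed.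

Definition eM := hexp M c lam mu.
Definition eMb := hexp Mb cb (- lam) (- mu).

Lemma AmatE x y n1 n2 : Amat M Mb c lam mu x y n1 n2 =
  \matrix_(j, k) (eM x y n1 n2 k / (Mb j - M k)).
Proof.
rewrite /Amat /A0 !LmE // !HmE // diagf_linear mexp_diagf !diagf_exprz;
  try by move=> j; exact: hfac_neq0.
by rewrite !mul_cauchy_diag.
Qed.

Lemma AbmatE x y n1 n2 : Abmat M Mb cb lam mu x y n1 n2 =
  \matrix_(j, k) (eMb x y n1 n2 k / (M j - Mb k)).
Proof.
have LbmE z : Lbm Mb z = Lm Mb (- z) by rewrite /Lbm /Lm Hbm_Hm.
rewrite /Abmat /Ab0 !LbmE !Hbm_Hm !LmE // !HmE // diagf_linear mexp_diagf !diagf_exprz;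
  try by move=> j; exact: hfac_neq0.
by rewrite !mul_cauchy_diag.
Qed.

Definition Wmat x y n1 n2 := cauchyW M Mb (eM x y n1 n2) (eMb x y n1 n2).

Lemma tauE x y n1 n2 : tau M Mb c cb lam mu x y n1 n2 = \det (Wmat x y n1 n2).
Proof. by rewrite /tau AmatE AbmatE -det_1mxM_block. Qed.

Lemma Wmat_shift x y n1 n2 s t a1 a2 b1 b2 :
  (forall j, hfac M lam j ^ (s + t) * hfac M mu j ^ (t - s)
     = (M j - a1) * (M j - a2) / ((M j - b1) * (M j - b2))) ->
  (forall j, hfac Mb (- lam) j ^ (s + t) * hfac Mb (- mu) j ^ (t - s)
     = (Mb j - b1) * (Mb j - b2) / ((Mb j - a1) * (Mb j - a2))) ->
  Wmat x y (n1 + s) (n2 + t) =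
  cauchyW M Mb (miwa_shift M a1 a2 b1 b2 (eM x y n1 n2)) (miwa_shiftb Mb a1 a2 b1 b2 (eMb x y n1 n2)).
Proof.
move=> h1 h2; rewrite /Wmat; congr cauchyW; apply/funext => j.
  by rewrite /eM hexp_shift // h1 /miwa_shift mulrA.
by rewrite /eMb hexp_shift // h2 /miwa_shiftb mulrA.
Qed.

Ltac solve_shift :=
  move=> j; rewrite ?hfacN /hfac ?opprK /= ?expr1z ?expr0z ?exprN1 ?mulr1 ?mul1r ?invf_div;
  field; rewrite ?(regular_neq0 _ rl) ?(regular_neq0 _ rm) ?(regular_neq0 _ rlb) ?(regular_neq0 _ rmb).

(** A step in [n1] multiplies by [(M - lam)(M + mu) / ((M + lam)(M - mu))]; the backward step
    inverts this, exchanging zeros and poles. *)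
Lemma Wmat_n1S x y n1 n2 : Wmat x y (n1 + 1) n2 =
  cauchyW M Mb (miwa_shift M lam (- mu) (- lam) mu (eM x y n1 n2))
               (miwa_shiftb Mb lam (- mu) (- lam) mu (eMb x y n1 n2)).
Proof. by rewrite -{1}[n2]addr0; apply: Wmat_shift; rewrite ?addr0 ?sub0r; solve_shift. Qed.

Lemma Wmat_n1P x y n1 n2 : Wmat x y (n1 - 1) n2 =
  cauchyW M Mb (miwa_shift M (- lam) mu lam (- mu) (eM x y n1 n2))
               (miwa_shiftb Mb (- lam) mu lam (- mu) (eMb x y n1 n2)).
Proof.
by rewrite -{1}[n2]addr0; apply: Wmat_shift; rewrite ?addr0 ?sub0r ?opprK; solve_shift.
Qed.

(** Here both factors enter directly: [(M - lam)(M - mu) / ((M + lam)(M + mu))]. *)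
Lemma Wmat_n2S x y n1 n2 : Wmat x y n1 (n2 + 1) =
  cauchyW M Mb (miwa_shift M lam mu (- lam) (- mu) (eM x y n1 n2))
               (miwa_shiftb Mb lam mu (- lam) (- mu) (eMb x y n1 n2)).
Proof. by rewrite -{1}[n1]addr0; apply: Wmat_shift; rewrite ?add0r ?subr0; solve_shift. Qed.

Lemma Wmat_n2P x y n1 n2 : Wmat x y n1 (n2 - 1) =
  cauchyW M Mb (miwa_shift M (- lam) (- mu) lam mu (eM x y n1 n2))
               (miwa_shiftb Mb (- lam) (- mu) lam mu (eMb x y n1 n2)).
Proof. by rewrite -{1}[n1]addr0; apply: Wmat_shift; rewrite ?add0r ?subr0; solve_shift. Qed.

Lemma is_derive_Wmat_x (x y : R) n1 n2 i j :
  is_derive x 1 (fun t => Wmat t y n1 n2 i j)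
    ((Wmat x y n1 n2 i j - (i == j)%:R) * flow_row M Mb lam 0 j).
Proof. by apply: is_derive_cauchyW => k; exact: is_derive_hexp_x. Qed.

Lemma is_derive_Wmat_y (x y : R) n1 n2 i j :
  is_derive y 1 (fun t => Wmat x t n1 n2 i j)
    ((Wmat x y n1 n2 i j - (i == j)%:R) * flow_row M Mb mu 0 j).
Proof. by apply: is_derive_cauchyW => k; exact: is_derive_hexp_y. Qed.

End Reduction.

(** * From determinants to the function [u] *)

Lemma expR_ln_second_difference (R : realType) (a b a' t s t' : R) :
  0 < t -> 0 < s -> 0 < t' ->
  expR (a + ln t - 2 * (b + ln s) + (a' + ln t')) =
  expR (a - 2 * b + a') * (t / s) * (t' / s).
Proof.
move=> t0 s0 t0'.
have -> : a + ln t - 2 * (b + ln s) + (a' + ln t') =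
    (a - 2 * b + a') + (ln t - ln s) + (ln t' - ln s) by ring.
by rewrite !expRD !expRN !lnK // posrE.
Qed.

(** A [derive1] that fails to converge would take a default value; the derivability clauses ensure
    that the derivatives are genuine. *)
Theorem theorem1 (R : realType) (n : nat) (lam mu : R) (M Mb c cb : 'I_n.+1 -> R)
  (hlam : lam != 0) (hmu : mu != 0) (hlm : lam ^+ 2 != mu ^+ 2)
  (hMM : forall j k, Mb j != M k)
  (hlamM : forall j, [/\ lam != M j, lam != - M j, lam != Mb j & lam != - Mb j])
  (hmuM : forall j, [/\ mu != M j, mu != - M j, mu != Mb j & mu != - Mb j])
  (hdet : forall (x y : R) (n1 n2 : int), 0 < tau M Mb c cb lam mu x y n1 n2) :
  let U := u M Mb c cb lam mu in
  forall (x y : R) (n1 n2 : int),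
    (forall x' y' : R, derivable (fun y'' => U x' y'' n1 n2) y' 1) /\
    derivable (fun x' => derive1 (fun y' => U x' y' n1 n2) y) x 1 /\
    derive1 (fun x' => derive1 (fun y' => U x' y' n1 n2) y) x =
      expR (U x y (n1 + 1) n2 - 2 * U x y n1 n2 + U x y (n1 - 1) n2)
      - expR (U x y n1 (n2 + 1) - 2 * U x y n1 n2 + U x y n1 (n2 - 1)).
Proof.
move=> U x y n1 n2.
have [ol ol' rl rlb] := spectral_conditions hlamM.
have [om om' rm rmb] := spectral_conditions hmuM.
have nlm : lam != mu by apply: contraNneq hlm => ->.
have nlm' : lam != - mu by apply: contraNneq hlm => ->; rewrite sqrrN.
have n1m : lam - mu != 0 by rewrite subr_eq0.
have n2m : lam + mu != 0 by rewrite addr_eq0.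
pose W := Wmat M Mb c cb lam mu.
have tE x' y' k1 k2 : tau M Mb c cb lam mu x' y' k1 k2 = \det (W x' y' k1 k2).
  exact: tauE.
have W0 x' y' k1 k2 : 0 < \det (W x' y' k1 k2) by rewrite -tE.
pose A := lam * mu * (lam ^+ 2 + mu ^+ 2); pose B := (lam ^+ 2 - mu ^+ 2) ^+ 2.
pose Ln := ln `|(lam + mu) / (lam - mu)|.
have UE x' y' k1 k2 : U x' y' k1 k2 =
    8 * x' * y' * A / B + (k1 ^+ 2 - k2 ^+ 2)%:~R * Ln + ln (\det (W x' y' k1 k2)).
  by rewrite /U /u /phi tE.
pose Q := diag_mx (flow_row M Mb mu).
pose P := diag_mx (flow_row M Mb lam).
have dy (x' y' : R) : is_derive y' 1 (fun y'' => U x' y'' n1 n2)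
    (8 * x' * A / B + (\tr Q - \tr (invmx (W x' y' n1 n2) *m Q))).
  under eq_fun do rewrite UE.
  apply: is_derive_add; last first.
    exact: (is_derive_ln_det_flow (W := fun a b => W a b n1 n2)
      (fun a b i j => is_derive_Wmat_y M Mb c cb lam mu a b n1 n2 i j)
      (fun a b => W0 a b n1 n2) x' y').
  have h := is_derive_add (is_derive_mulc B^-1 (is_derive_mulc A
    (is_derive_cmul (8 * x') (is_derive_id y' 1))))
    (is_derive_cst ((n1 ^+ 2 - n2 ^+ 2)%:~R * Ln) y' 1).
  by apply: (is_derive_eq h); rewrite addr0 mulr1.
have dyE : (fun x' => derive1 (fun y' => U x' y' n1 n2) y) =
    (fun x' => 8 * x' * A / B + (\tr Q - \tr (invmx (W x' y n1 n2) *m Q))).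
  by apply/funext => x'; rewrite derive1E; case: (dy x' y).
have dx : is_derive x 1 (fun x' => derive1 (fun y' => U x' y' n1 n2) y)
    (8 * A / B + (\tr (invmx (W x y n1 n2) *m P *m Q)
       - \tr (invmx (W x y n1 n2) *m P *m invmx (W x y n1 n2) *m Q))).
  rewrite dyE; apply: is_derive_add; last first.
    exact: (is_derive_mixed_ln_det (W := fun a b => W a b n1 n2) (flow_row M Mb mu)
      (fun a b i j => is_derive_Wmat_x M Mb c cb lam mu a b n1 n2 i j)
      (fun a b => W0 a b n1 n2) x y).
  have h := is_derive_mulc B^-1 (is_derive_mulc A (is_derive_cmul 8 (is_derive_id x 1))).
  by apply: (is_derive_eq h); rewrite mulr1.
split; first by move=> x' y'; case: (dy x' y').
split; first by case: dx.
rewrite derive1E; case: dx => _ ->.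
have dW : \det (W x y n1 n2) != 0 by rewrite gt_eqF.
have := cauchy_toda hMM dW ol ol' om om' nlm nlm'; cbv zeta beta.
rewrite -!diag_flow_row // -/P -/Q -!Wmat_n1S // -!Wmat_n1P // -!Wmat_n2S // -!Wmat_n2P // -/W.
set r := ((lam + mu) / (lam - mu)) ^+ 2.
(* The mixed derivative of [phi] is exactly the term [r - r^-1] of [cauchy_toda]. *)
have rE : 8 * A / B = r - r^-1.
  rewrite /A /B /r; have -> : lam ^+ 2 - mu ^+ 2 = (lam - mu) * (lam + mu) by ring.
  by field; rewrite n1m n2m.
rewrite rE addrC => ->.
rewrite !UE !expR_ln_second_difference //.
have s0 : 0 < `|(lam + mu) / (lam - mu)| by rewrite normr_gt0 mulf_neq0 // invr_neq0.
(* The absolute value disappears because [r] is a square. *)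
have eLn : expR (2 * Ln) = r.
  by rewrite expRM_natl lnK ?posrE // real_normK ?num_real.
(* In the second differences of [phi] the [x y] term cancels; the squares leave [2 * Ln] for [n1]
   and [- (2 * Ln)] for [n2]. *)
congr (_ * _ * _ - _ * _ * _).
  rewrite -eLn; congr expR; rewrite !rmorphB !rmorphXn /= !rmorphD /= ?rmorphN1; ring.
rewrite -eLn -expRN; congr expR; rewrite !rmorphB !rmorphXn /= !rmorphD /= ?rmorphN1; ring.
Qed.
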